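(* Let $X$ be a real random variable with finite second moment and with a continuous density $p$ of bounded total variation on $\mathbb{R}$. Let $f(t)=\mathbb{E}\,e^{itX}$, $t\in\mathbb{R}$, and assume that $f$ and its derivatives $f'$ and $f''$ are integrable on $\mathbb{R}$. Let $Z_n=\frac{1}{\sqrt n}(X+X_1+\dots+X_n)$, where $(X_n)_{n\ge1}$ are independent Bernoulli random variables taking the values $\pm1$ with probability $1/2$ each, independent of $X$. Then $Z_n$ have uniformly bounded densities $p_n$ satisfying, as $n\to\infty$, uniformly over all $x\in\mathbb{R}$, $$p_n(x)=A_n(x)\,\varphi(x)+O\Big(\frac{\log n}{\sqrt n}\Big),$$ where $$A_n(x)=\sum_{k\in\mathbb{Z}}e^{-i\pi k(x\sqrt n+n)}f(\pi k)=2\sum_{m\in\mathbb{Z}}p(2m+x\sqrt n+n).$$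
   Context: $\varphi(x)=\frac{1}{\sqrt{2\pi}}e^{-x^2/2}$ is the standard normal density on $\mathbb{R}$. The constant in $O(\cdot)$ may depend on the distribution of $X$ but not on $x$ or $n$. *)

(* Defs.v *)
From HB Require Import structures.
From mathcomp Require Import all_boot all_order all_algebra finmap.
From mathcomp Require Import all_classical all_reals all_analysis.
From mathcomp Require Import complex.
From mathcomp Require summability.

Set Implicit Arguments.
Unset Strict Implicit.
Unset Printing Implicit Defensive.

Import Order.TTheory GRing.Theory Num.Theory.
Import numFieldNormedType.Exports.

Local Open Scope classical_set_scope.
Local Open Scope ring_scope.
Local Open Scope complex_scope.

Section complex_valued.
Context {R : realType}.
Implicit Types (f : R -> R[i]) (t : R).

(* e^{i t} *)
Definition expi t : R[i] := cos t +i* sin t.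

(* Complex functions of a real variable are differentiated and integrated
   through their real and imaginary parts, because [R[i]] is not equipped with
   a normed space structure over [R] nor with a measurable structure. *)
Definition cderive1 f : R -> R[i] :=
  fun t => derive1 (fun s => complex.Re (f s)) t +i* derive1 (fun s => complex.Im (f s)) t.

Definition cintegrable f : Prop :=
  (@lebesgue_measure R).-integrable setT (fun t => (complex.Re (f t))%:E) /\
  (@lebesgue_measure R).-integrable setT (fun t => (complex.Im (f t))%:E).

End complex_valued.

Section real_line.
Context {R : realType}.

Definition bounded_total_variation (q : R -> R) : Prop :=
  exists V : R, forall a b : R, a <= b -> (total_variation a b q <= V%:E)%E.

End real_line.

Section random_variables.
Context d (T : measurableType d) (R : realType) (P : probability T R).

Definition is_density (Y : T -> R) (q : R -> R) : Prop :=
  [/\ measurable_fun setT q,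
      forall x, 0 <= q x &
      forall B : set R, measurable B ->
        P (Y @^-1` B) = (\int[lebesgue_measure]_(x in B) (q x)%:E)%E].

(* E e^{i t Y} *)
Definition charfun (Y : T -> R) (t : R) : R[i] :=
  fine 'E_P[fun w => cos (t * Y w)] +i* fine 'E_P[fun w => sin (t * Y w)].

Definition mutually_independent (Y : nat -> T -> R) : Prop :=
  forall (J : {fset nat}) (B : nat -> set R),
    (forall j, measurable (B j)) ->
    P (\bigcap_(j in [set` J]) Y j @^-1` B j) =
    (\prod_(j <- J) P (Y j @^-1` B j))%E.

Definition symmetric_bernoulli (Y : T -> R) : Prop :=
  P (Y @^-1` [set 1]) = (2^-1)%:E /\ P (Y @^-1` [set -1]) = (2^-1)%:E.

(* The sequence X, xi 0, xi 1, ...  Indices are shifted: [xi i] is the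
   variable X_{i+1} of the mathematical sequence (X_n)_{n >= 1}. *)
Definition cons_rv (X : T -> R) (xi : nat -> T -> R) (k : nat) : T -> R :=
  if k is i.+1 then xi i else X.

Definition Zsum (X : T -> R) (xi : nat -> T -> R) (n : nat) (w : T) : R :=
  (X w + \sum_(i < n) xi i w) / Num.sqrt n%:R.

End random_variables.

Section A_n.
Context {R : realType}.

(* [partial_sum u @ totally] is the net of the sums of [u] over the finite
   subsets of [int] ordered by inclusion: its convergence is unconditional
   summability over the integers, and [summability.sum u] is its limit. *)
Definition summableZ (K : numFieldType) (V : normedModType K) (u : int -> V) :
  Prop := cvg (summability.partial_sum u @ summability.totally).

(* [R[i]^o] is [R[i]] with its usual topology *)
Definition fourier_term (f : R -> R[i]) (n : nat) (x : R) (k : int) : R[i]^o :=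
  expi (- (pi * k%:~R * (x * Num.sqrt n%:R + n%:R))) * f (pi * k%:~R).

Definition lattice_term (p : R -> R) (n : nat) (x : R) (m : int) : R :=
  p (2 * m%:~R + x * Num.sqrt n%:R + n%:R).

Definition A_ (f : R -> R[i]) (n : nat) (x : R) : R[i] :=
  summability.sum (fourier_term f n x).

End A_n.

(* Main.v *)
(* By conditioning on the Bernoulli sum, Z_n has the density
     p_n(x) = sqrt n * sum_(k <= n) b(n, k) p(x sqrt n - n + 2 k),   b(n, k) = 'C(n, k) / 2^n.
   The local limit theorem with rate, sqrt n * b(n, k) = 2 phi((n - 2k) / sqrt n) + O(1 / sqrt n),
   and the Lipschitz continuity of phi replace each weight by 2 phi(x), at the cost of
   O((1 + |y_m|) / sqrt n), or of O(1) at worst, where y_m = 2m + x sqrt n + n is the argument of p.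
   Since f and f'' are integrable, p and x^2 p are bounded, so p(y) = O(1 / (1 + y^2)), and the
   total error is
     sum_(l < n) O(1 / (sqrt n (1 + l))) + sum_(l >= n) O(1 / (1 + l^2)) = O(log n / sqrt n).
   What remains is 2 phi(x) sum_m p(2m + x sqrt n + n) = A_n(x) phi(x), by Poisson summation: the
   samples f(pi k) are absolutely summable because f and f' are integrable, so the Fourier series
   may be summed in the Cesaro sense, against the nonnegative Fejer kernel. *)

Require Import Defs.
From HB Require Import structures.
From mathcomp Require Import all_boot all_order all_algebra finmap.
From mathcomp Require Import all_classical all_reals all_analysis.
From mathcomp Require Import measurable_realfun.
From mathcomp Require Import complex.
From mathcomp Require summability.
From mathcomp Require Import ring lra zify.

Set Implicit Arguments.
Unset Strict Implicit.
Unset Printing Implicit Defensive.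

Import Order.TTheory GRing.Theory Num.Theory.
Import numFieldNormedType.Exports.

Local Open Scope classical_set_scope.
Local Open Scope ring_scope.
Local Open Scope complex_scope.

(** Fourier inversion is avoided throughout: wherever the transform has to control [p] itself,
    [p >= 0] is integrated against a nonnegative kernel. Positivity lets the integral be cut down to
    a window for a lower bound, both when bounding [p] and in Poisson summation. The local limit
    theorem is needed only with an additive error uniform in [k], of the same order as the Lipschitz
    error of [phi] over one lattice step. It is therefore proved by elementary means with an
    explicit constant: Wallis integrals for the central coefficient, then an induction outward
    through ratios of consecutive coefficients. The constants of the conclusion are fixed before the
    probability space, knowing only [p]. All errors are accordingly expressed through one number
    [K0] with [p x <= K0 / (1 + x ^+ 2)], and the final proof first decides whether such a number
    exists. Sums over the integers are limits along finite subsets, so each convergence is split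
    into symmetric partial sums and a tail controlled uniformly over finite sets. *)

(** * Integrals over intervals and affine changes of variables *)

Section interval_integrals.
Context {R : realType}.
Notation mu := (@lebesgue_measure R).
Implicit Types (f F : R -> R) (a b : R).

Lemma continuous_integrable_itv f a b :
  continuous f -> mu.-integrable `[a, b] (EFin \o f).
Proof.
move=> cf; apply: continuous_compact_integrable; first exact: segment_compact.
exact: continuous_subspaceT.
Qed.

Lemma integral_of_derivative F f a b : a <= b ->
  (forall x : R, is_derive x 1 F (f x)) -> continuous f ->
  \int[mu]_(x in `[a, b]) f x = F b - F a.
Proof.
rewrite le_eqVlt => /predU1P[<- _ _|ab dF cf].
  by rewrite set_itv1 Rintegral_set1 subrr.
rewrite /Rintegral (@continuous_FTC2 R f F)//.
- exact: continuous_subspaceT.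
- have cF : continuous F.
    move=> x; apply: differentiable_continuous.
    by apply/derivable1_diffP; case: (dF x).
  split; first by move=> x _; case: (dF x).
    by apply: cvg_at_right_filter; exact: cF.
  by apply: cvg_at_left_filter; exact: cF.
- by move=> x _; rewrite derive1E; case: (dF x).
Qed.

Lemma EFin_Rintegral (D : set (measurableTypeR R)) f : measurable D ->
  mu.-integrable D (EFin \o f) ->
  (\int[mu]_(x in D) (f x)%:E)%E = (\int[mu]_(x in D) f x)%:E.
Proof. by move=> mD intf; rewrite /Rintegral fineK// integrable_fin_num. Qed.

End interval_integrals.

Section affine.
Context {R : realType}.
Notation mu := (@lebesgue_measure R).
Variables (a b : R).
Hypothesis a0 : 0 < a.

Let phi (y : measurableTypeR R) : measurableTypeR R := (y - b) / a.

Let mphi : measurable_fun setT phi.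
Proof. by apply: measurable_funM => //; exact: measurable_funB. Qed.

Let push : {measure set (measurableTypeR R) -> \bar R}.
Proof.
by refine [the {measure set (measurableTypeR R) -> \bar R} of pushforward mu phi];
  exact: mphi.
Defined.

Let va : 0 <= a^-1. Proof. by rewrite invr_ge0 ltW. Qed.

Let nu : {measure set (measurableTypeR R) -> \bar R} :=
  mscale (NngNum va) push.

(** By uniqueness of Lebesgue measure it is enough to compare half-open intervals; the factor [a^-1]
    undoes the dilation. *)
Let nuE (A : set (measurableTypeR R)) : measurable A -> nu A = mu A.
Proof.
move=> mA; apply/esym/lebesgue_measure_unique => //= _ [[u v]] _ <-.
rewrite /nu /mscale/= /push/= /pushforward.
have -> : phi @^-1` `]u, v] = `](a * u + b), (a * v + b)]%classic.
  apply/seteqP; split=> y; rewrite /phi/= !in_itv/= ltr_pdivlMr// ler_pdivrMr//;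
    by rewrite ltrBrDr lerBlDr !(mulrC a).
rewrite !lebesgue_measure_itv/= !lte_fin ltrD2r ltr_pM2l//.
case: ifP => _; last by rewrite mule0.
rewrite -!EFinD -EFinM; congr EFin.
by field; rewrite gt_eqF.
Qed.

(** Serves both translations ([a = 1]) and the normalization by [sqrt n] ([b = 0]), which is why
    domains of the form [(y - c) / 1] occur later. *)
Lemma ge0_integral_affine (B : set (measurableTypeR R)) (f : R -> R) :
  measurable B -> measurable_fun setT f -> (forall x, 0 <= f x) ->
  (\int[mu]_(x in [set y | B ((y - b) / a)%R]) (f x)%:E =
   \int[mu]_(x in B) (a * f (a * x + b)%R)%:E)%E.
Proof.
move=> mB mf f0.
have mg : measurable_fun B (fun x : measurableTypeR R => (f (a * x + b))%:E).
  apply/measurable_funTS/measurable_EFinP/(measurableT_comp mf).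
  by apply: measurable_funD => //; exact: measurable_funM.
transitivity (\int[mu]_(x in phi @^-1` B)
    (((fun x => (f (a * x + b))%:E) \o phi) x))%E.
  apply: eq_integral => y _ /=; congr (f _)%:E.
  by rewrite /phi mulrCA divff ?gt_eqF// mulr1 subrK.
rewrite -(ge0_integral_pushforward mphi)//; last by move=> y _; rewrite lee_fin.
have -> : (\int[mu]_(x in B) (a * f (a * x + b))%:E =
    \int[nu]_(x in B) (a * f (a * x + b))%:E)%E.
  by apply: eq_measure_integral => A mA _; rewrite nuE.
rewrite /nu ge0_integral_mscale//; last 2 first.
- by under eq_fun do rewrite EFinM; apply: emeasurable_funM => //; exact: measurable_cst.
- by move=> y _; rewrite lee_fin mulr_ge0// ltW.
under eq_integral do rewrite EFinM.
rewrite ge0_integralZl//; last 2 first.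
- by move=> y _; rewrite lee_fin.
- by rewrite lee_fin ltW.
by rewrite muleA -EFinM/= mulVf ?gt_eqF// mul1e.
Qed.

End affine.

(** * The local limit theorem for symmetric Bernoulli sums *)

Section wallis.
Context {R : realType}.
Notation mu := (@lebesgue_measure R).

Lemma continuous_cosX n : continuous (fun x : R => cos x ^+ n).
Proof.
move=> x; apply: (@continuous_comp _ _ _ cos (fun y : R => y ^+ n)).
  exact: continuous_cos.
exact: exprn_continuous.
Qed.

Definition wallis (n : nat) : R := \int[mu]_(x in `[0, pi / 2]) cos x ^+ n.

Let pihalf_ge0 : 0 <= pi / 2 :> R.
Proof. by rewrite divr_ge0// pi_ge0. Qed.

Lemma wallis0 : wallis 0 = pi / 2.
Proof.
rewrite /wallis (@integral_of_derivative _ (fun x => x) (fun x => cos x ^+ 0))//.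
  by rewrite subr0.
exact: continuous_cosX.
Qed.

Lemma wallis1 : wallis 1 = 1.
Proof.
rewrite /wallis (@integral_of_derivative _ (@sin R) (fun x => cos x ^+ 1))//.
- by rewrite sin_pihalf sin0 subr0.
- exact: continuous_cosX.
Qed.

(** The difference of the two sides is the integral of the derivative of [cos ^+ n.+1 * sin], which
    vanishes at both [0] and [pi / 2]. *)
Lemma wallisSS n : n.+2%:R * wallis n.+2 = n.+1%:R * wallis n.
Proof.
apply/eqP; rewrite -subr_eq0; apply/eqP.
rewrite /wallis -!RintegralZl//; try by apply: continuous_integrable_itv; exact: continuous_cosX.
rewrite -RintegralB//; [|apply: continuous_integrable_itv..]; first last.
- by move=> x; apply: cvgM; [exact: cvg_cst|exact: continuous_cosX].
- by move=> x; apply: cvgM; [exact: cvg_cst|exact: continuous_cosX].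
have dF (x : R) : is_derive x 1 (cos ^+ n.+1 * sin : R -> R)
    (n.+2%:R * cos x ^+ n.+2 - n.+1%:R * cos x ^+ n).
  apply: is_derive_eq.
  rewrite /GRing.scale/= !exprS (mulrA (sin x)).
  have := cos2Dsin2 x; rewrite -!natr1 !expr2 => H.
  rewrite !fctE.
  transitivity (cos x ^+ n * ((cos x * cos x) - n.+1%:R * (sin x * sin x))).
    by rewrite -natr1; ring.
  have -> : sin x * sin x = 1 - cos x * cos x by rewrite -H addrAC subrr add0r.
  by rewrite -natr1; ring.
rewrite (integral_of_derivative _ dF)//.
- by rewrite !fctE cos_pihalf sin0 expr0n /= mulr0 mul0r subr0.
- move=> x; apply: cvgB; (apply: cvgM; [exact: cvg_cst|exact: continuous_cosX]).
Qed.

Lemma wallis_ge0 n : 0 <= wallis n.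
Proof.
apply: Rintegral_ge0 => x /=; rewrite in_itv/= => /andP[x0 xp].
by rewrite exprn_ge0// cos_ge0_pihalf// xp andbT (le_trans _ x0)// oppr_le0.
Qed.

Lemma wallis_decr n : wallis n.+1 <= wallis n.
Proof.
apply: le_Rintegral => //; try by apply: continuous_integrable_itv; exact: continuous_cosX.
move=> x /=; rewrite in_itv/= => /andP[x0 xp].
have c0 : 0 <= cos x by rewrite cos_ge0_pihalf// xp andbT (le_trans _ x0)// oppr_le0.
by rewrite exprS ler_piMl ?exprn_ge0// cos_le1.
Qed.

(** By the two-step recursion this product does not depend on [n]. It is the only source of [pi] in
    the estimate of the central coefficient. *)
Lemma wallis_mulS n : n.+1%:R * (wallis n * wallis n.+1) = pi / 2.
Proof.
elim: n => [|n IH]; first by rewrite wallis0 wallis1 mul1r mulr1.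
by rewrite mulrCA wallisSS mulrCA (mulrC (wallis n.+1)).
Qed.

Lemma wallis_bin m : wallis m.*2 = pi / 2 * ('C(m.*2, m)%:R / 2 ^+ m.*2).
Proof.
elim: m => [|m IH]; first by rewrite wallis0 bin0 expr0 divr1 mulr1.
have := wallisSS m.*2; rewrite -doubleS IH.
have h : (m.+1%:R * 'C(m.+1.*2, m.+1)%:R = 2 * m.*2.+1%:R * 'C(m.*2, m)%:R :> R)%R.
  rewrite -!natrM; congr (_%:R).
  rewrite doubleS -mul_bin_diag /=.
  apply/eqP; rewrite -(eqn_pmul2l (ltn0Sn m)); apply/eqP.
  have e : 'C(m.*2.+1, m) = 'C(m.*2.+1, m.+1).
    by rewrite -bin_sub ?subSn -?addnn ?addnK// ?leqW ?leq_addr.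
  rewrite e mulnCA -mul_bin_diag /=.
  by rewrite -muln2; lia.
move=> h2.
have e1 : m.+1.*2%:R = 2 * m.+1%:R :> R by rewrite -muln2 natrM mulrC.
have n0 : m.+1.*2%:R != 0 :> R by rewrite pnatr_eq0.
apply: (mulfI n0); rewrite h2.
have n1 : m.+1%:R != 0 :> R by rewrite pnatr_eq0.
rewrite e1 doubleS !exprS.
have -> : 2 * m.+1%:R * (pi / 2 * ('C(m.*2.+2, m.+1)%:R / (2 * (2 * 2 ^+ m.*2)))) =
   pi / 2 * ((m.+1%:R * 'C(m.*2.+2, m.+1)%:R) / (2 * 2 ^+ m.*2)) :> R.
  field. by rewrite expf_neq0.
rewrite -doubleS h; field; by rewrite expf_neq0.
Qed.

(* the even Wallis integral squared is pinched between
   [wallis m.*2 * wallis m.*2.+1] and [wallis m.*2 * wallis m.*2.-1] *)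
Lemma central_bin_bounds m (w : R) : (0 < m)%N ->
  w = 'C(m.*2, m)%:R / 2 ^+ m.*2 ->
  2 / pi / m.*2.+1%:R <= w ^+ 2 <= 2 / pi / m.*2%:R.
Proof.
move=> m0 wdef.
have wE : w = 2 / pi * wallis m.*2.
  rewrite wallis_bin -wdef; move: pi (pi_gt0 R) => c c0; field.
  by rewrite gt_eqF.
have pi0 := pi_gt0 R.
have eq2 : w ^+ 2 = 2 / pi * (2 / pi * wallis m.*2 ^+ 2).
  by rewrite wE; ring.
rewrite eq2 -!(mulrA 2%R _ (_^-1)%R) -!mulrA !ler_pM2l ?invr_gt0//.
have inv k (W : R) : (0 < k)%N -> k%:R * W = pi / 2 -> k%:R^-1 = 2 / pi * W.
  move: (pi : R) pi0 => c c0 k0 h.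
  have kn : k%:R != 0 :> R by rewrite pnatr_eq0 -lt0n.
  have cn : c != 0 by rewrite gt_eqF.
  have -> : W = c / 2 / k%:R by rewrite -h mulrC mulKf.
  by field; rewrite kn cn.
apply/andP; split.
  rewrite (inv _ _ _ (wallis_mulS _))// [leRHS]mulrA.
  rewrite ler_wpM2l//; first by rewrite divr_ge0// ltW.
  by rewrite expr2 ler_wpM2l ?wallis_ge0// wallis_decr.
case: m m0 wdef wE eq2 => // m _ wdef wE eq2.
rewrite doubleS (inv _ _ _ (wallis_mulS _))// mulrA.
rewrite ler_wpM2l//; first by rewrite divr_ge0// ltW.
by rewrite expr2 ler_wpM2r ?wallis_ge0// wallis_decr.
Qed.

End wallis.

Section local_clt.
Context {R : realType}.
Notation phi := (@normal_pdf R 0 1).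

Definition bin_half (n k : nat) : R := 'C(n, k)%:R / 2 ^+ n.

Lemma normal_pdf01E x : phi x = normal_peak 1 * expR (- (x ^+ 2 / 2)).
Proof.
by rewrite /normal_pdf oner_eq0 /normal_fun subr0 expr1n mulNr.
Qed.

Lemma normal_peak1_sqr : (2 * normal_peak 1) ^+ 2 = 2 / pi :> R.
Proof.
rewrite /normal_peak expr1n mul1r exprMn exprVn; move: (pi : R) (pi_gt0 R) => c c0.
rewrite sqr_sqrtr ?mulrn_wge0 ?ltW// -mulr_natr; field; by rewrite gt_eqF.
Qed.

Lemma normal_peak1_le : 2 * normal_peak 1 <= 1 :> R.
Proof.
rewrite -(@ler_pXn2r _ 2)// ?nnegrE ?mulr_ge0 ?normal_peak_ge0//.
by rewrite normal_peak1_sqr expr1n ler_pdivrMr ?pi_gt0// mul1r pi_ge2.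
Qed.

Lemma expRN_le_inv (x : R) : 0 <= x -> expR (- x) <= (1 + x)^-1.
Proof.
move=> x0; rewrite expRN lef_pV2 ?expR_ge1Dx// posrE ?expR_gt0//.
by rewrite ltr_pwDl.
Qed.

(** For odd [n] the middle probability equals the central one of the next even number, since
    ['C(2m+2, m+1) = 2 'C(2m+1, m)]. The Wallis bounds for even exponents thus cover both
    parities. *)
Lemma uphalf_bin n : bin_half n n./2 = bin_half (uphalf n).*2 (uphalf n).
Proof.
rewrite /bin_half uphalf_half; have := odd_double_half n.
case: (odd n) => /= [|]; last by rewrite !add0n => ->.
rewrite !add1n => h; rewrite -{1 3}h doubleS; set m := n./2.
have -> : 'C(m.*2.+2, m.+1) = (2 * 'C(m.*2.+1, m))%N.
  rewrite binS; suff -> : 'C(m.*2.+1, m.+1) = 'C(m.*2.+1, m) by rewrite mul2n addnn.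
  by rewrite -bin_sub; [congr binomial; lia|lia].
by rewrite natrM (exprS _ m.*2.+1); field; rewrite expf_neq0.
Qed.

(** * Induction outward from the central binomial coefficient *)

Section ratio.
Variable n : nat.
Hypothesis n0 : (0 < n)%N.
Let rt : R := Num.sqrt n%:R.
Let nR : 0 < n%:R :> R. Proof. by rewrite ltr0n. Qed.
Let rt0 : 0 < rt. Proof. by rewrite sqrtr_gt0. Qed.
Let rtE : rt ^+ 2 = n%:R. Proof. by rewrite sqr_sqrtr// ltW. Qed.
Let rt1 : 1 <= rt. Proof. by rewrite -sqrtr1 ler_wsqrtr// ler1n. Qed.
Let h := n./2.
(** The value of [n - 2k] at [k = h - i], so that [i] counts steps away from the centre; [B i] and
    [G i] are the binomial and the Gaussian weight at that [k]. *)
Let j (i : nat) : R := (odd n + i.*2)%:R.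
Let B i : R := rt * bin_half n (h - i).
Let G i : R := 2 * phi (j i / rt).
(* [32 / rt * g i], with a variance twice that of [G i], is the decreasing
   quantity that pays for the error made when the ratio of consecutive binomial
   coefficients is replaced by the ratio of consecutive Gaussian values. *)
Let g i : R := expR (- (j i ^+ 2 / (4 * n%:R))).

Let peak0 : 0 <= 2 * normal_peak 1 :> R.
Proof. by rewrite mulr_ge0 ?normal_peak_ge0. Qed.

Let j_ge0 i : 0 <= j i. Proof. exact: ler0n. Qed.

Let GE i : G i = 2 * normal_peak 1 * expR (- (j i ^+ 2 / (2 * n%:R))).
Proof.
rewrite /G normal_pdf01E mulrA; congr (_ * expR (- _)).
by rewrite expr_div_n rtE; field; rewrite gt_eqF.
Qed.

Let G_le i : G i <= g i ^+ 2.
Proof.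
rewrite GE /g [leRHS]expr2 -expRD.
apply: (le_trans (ler_wpM2r (expR_ge0 _) normal_peak1_le)).
rewrite mul1r ler_expR -opprD lerN2 le_eqVlt; apply/orP; left; apply/eqP; field.
by rewrite gt_eqF.
Qed.

(** With [c = 2 * normal_peak 1], whose square is [2 / pi], both values lie between
    [c * (1 - 2 / n)] and [c]: the first by the Wallis bounds, the second because [j 0] is 0 or 1.
    Finally [2 / n <= 2 / rt]. *)
Let B0 : `|B 0 - G 0| <= 2 / rt.
Proof.
have c1 := normal_peak1_le; have csq := normal_peak1_sqr; have c0 := peak0.
set c := 2 * normal_peak 1 in c1 csq c0.
have m0 : (0 < uphalf n)%N by rewrite uphalf_half; lia.
have := central_bin_bounds m0 (uphalf_bin n).
set w := bin_half _ _.
have w0 : 0 <= w by rewrite divr_ge0.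
rewrite -csq => /andP[wl wu].
have BE : B 0 = rt * w by rewrite /B subn0.
have d1 : ((uphalf n).*2.+1 <= n.+2)%N by lia.
have d2 : (n <= (uphalf n).*2)%N by lia.
have Bl : c * (n%:R / n.+2%:R) <= B 0.
  rewrite -(@ler_pXn2r _ 2)// ?nnegrE ?mulr_ge0 ?normal_peak_ge0 ?BE ?mulr_ge0 ?(ltW rt0)//.
  rewrite [leRHS]exprMn rtE exprMn.
  have : c ^+ 2 / n.+2%:R <= w ^+ 2.
    by apply: le_trans wl; rewrite ler_wpM2l ?sqr_ge0// lef_pV2 ?posrE// ler_nat.
  move=> /(ler_wpM2l (ltW nR)); apply: le_trans.
  rewrite [leRHS]mulrCA; apply: ler_wpM2l; first exact: sqr_ge0.
  rewrite expr2 ler_piMr ?divr_ge0// ler_pdivrMr// mul1r ler_nat.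
  by clear; lia.
have Bu : B 0 <= c.
  rewrite -(@ler_pXn2r _ 2)// ?nnegrE ?BE ?mulr_ge0 ?(ltW rt0)//.
  rewrite exprMn rtE.
  have : w ^+ 2 <= c ^+ 2 / n%:R.
    apply: (le_trans wu); rewrite ler_wpM2l ?sqr_ge0// lef_pV2 ?posrE ?ltr0n ?ler_nat//.
    exact: leq_trans n0 d2.
  move=> /(ler_wpM2l (ltW nR)) /le_trans; apply.
  by rewrite mulrCA mulfV ?mulr1// gt_eqF.
have Gu : G 0 <= c.
  by rewrite GE -/c ler_piMr// -expR0 ler_expR oppr_le0 divr_ge0 ?sqr_ge0.
have Gl : c * (1 - 1 / (2 * n%:R)) <= G 0.
  rewrite GE -/c ler_wpM2l//; apply: le_trans (expR_ge1Dx _).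
  rewrite lerD2l lerN2 ler_wpM2r ?invr_ge0 ?mulr_ge0 ?(ltW nR)//.
  by rewrite /j addn0; case: (odd n); rewrite ?expr1n ?expr0n.
have e : n%:R / n.+2%:R = 1 - 2 / n.+2%:R :> R.
  by rewrite -natr1 -natr1; field; rewrite !natr1 pnatr_eq0.
rewrite e in Bl.
have f1 : 2 / n.+2%:R <= 2 / n%:R :> R.
  by rewrite ler_wpM2l// lef_pV2 ?posrE// ler_nat; clear; lia.
have f2 : 1 / (2 * n%:R) <= 2 / n%:R :> R.
  by rewrite ler_pdivrMr ?mulr_gt0// mulrACA mulVf ?gt_eqF//; lra.
have f3 : 2 / n%:R <= 2 / rt.
  rewrite ler_wpM2l// lef_pV2 ?posrE// -rtE expr2 ler_pMr//.
have f0 : 0 <= 2 / n%:R :> R by rewrite divr_ge0// ltW.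
have q (u : R) : 0 <= u -> u <= 2 / n%:R -> c * u <= 2 / rt.
  by move=> u0 un; rewrite (le_trans _ f3)// (le_trans _ un)// ler_piMl.
have q1 := q _ (divr_ge0 _ _) f1; have q2 := q _ (divr_ge0 _ _) f2.
rewrite mulrBr mulr1 in Bl; rewrite mulrBr mulr1 in Gl.
have {}q1 := q1 (ler0n _ _) (ler0n _ _).
have {}q2 : c * (1 / (2 * n%:R)) <= 2 / rt by apply: q2; rewrite ?mulr_ge0// ltW.
have squeeze (x y u v r d : R) : d - u <= x -> x <= d -> d - v <= y -> y <= d ->
    u <= r -> v <= r -> `|x - y| <= r.
  by move=> *; rewrite ler_norml; apply/andP; split; lra.
exact: squeeze Bl Bu Gl Gu q1 q2.
Qed.

Let ratio_B i : (i < h)%N -> B i.+1 = (h - i)%:R / (n - h + i.+1)%:R * B i.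
Proof.
move=> ih; rewrite /B /bin_half.
have d0 : (n - h + i.+1)%:R != 0 :> R by rewrite pnatr_eq0; lia.
have : ((n - h + i.+1)%:R * 'C(n, h - i.+1)%:R = (h - i)%:R * 'C(n, h - i)%:R :> R).
  rewrite -!natrM; congr (_%:R).
  have -> : (h - i = (h - i.+1).+1)%N by lia.
  rewrite mul_bin_left; congr muln; rewrite /h; lia.
move=> H.
have -> : 'C(n, h - i.+1)%:R = (h - i)%:R * 'C(n, h - i)%:R / (n - h + i.+1)%:R :> R.
  by rewrite -H mulrC mulKf.
have alg (r a c d e : R) : r * (a * c / d / e) = a / d * (r * (c / e)) by ring.
exact: alg.
Qed.

(** The drop of the exponent in one step: [(j i.+1 ^+ 2 - j i ^+ 2) / (4 n)]. Hence [g] is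
    multiplied by [expR (- s i)] and [G] by its square. *)
Let s i : R := (j i + 1) / n%:R.

Let s_ge0 i : 0 <= s i. Proof. by rewrite divr_ge0 ?addr_ge0 ?(ltW nR). Qed.

Let s_le1 i : (i < h)%N -> s i <= 1.
Proof.
move=> ih; rewrite ler_pdivrMr// mul1r /j natr1 ler_nat /h in ih *; lia.
Qed.

Let jS i : j i.+1 = j i + 2.
Proof. by rewrite /j -natrD; congr (_%:R); lia. Qed.

Let ratio_g i : g i.+1 = g i * expR (- s i).
Proof.
rewrite /g -expRD jS /s; congr expR; field; rewrite gt_eqF//.
Qed.

Let ratio_G i : G i.+1 = G i * expR (- (2 * s i)).
Proof.
rewrite !GE -[RHS]mulrA -expRD jS /s; congr (_ * expR _); field; rewrite gt_eqF//.
Qed.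

(** With [u = s i] and [t = 1 / n], the binomial ratio is [(1 + t - u) / (1 + t + u)]. As
    [t <= u <= 1], both it and [expR (- (2 * u))] lie between [1 - 2 u] and [1 - 2 u + 4 u ^+ 2]. *)
Let ratio_close i : (i < h)%N ->
  `|(h - i)%:R / (n - h + i.+1)%:R - expR (- (2 * s i))| <= 4 * s i ^+ 2.
Proof.
move=> ih; have s0 := s_ge0 i; have s1 := s_le1 ih.
have t0 : 0 <= (n%:R^-1 : R) <= s i.
  by rewrite invr_ge0 (ltW nR)/= /s ler_pdivlMr// mulVf ?gt_eqF// lerDr.
have -> : (h - i)%:R / (n - h + i.+1)%:R = (1 + n%:R^-1 - s i) / (1 + n%:R^-1 + s i).
  have e1 : (h - i)%:R = (n%:R - j i) / 2.
    apply: (@mulIf _ 2); rewrite // mulfVK// /j -natrM -natrB; first last.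
      by move: ih; rewrite /h; clear; lia.
    by congr (_%:R); move: ih; rewrite /h; clear; lia.
  have e2 : (n - h + i.+1)%:R = (n%:R + j i) / 2 + 1.
    apply: (@mulIf _ 2); rewrite // mulrDl mulfVK// mul1r /j -natrM -!natrD.
    by congr (_%:R); move: ih; rewrite /h; clear; lia.
  rewrite e1 e2 /s; field; rewrite gt_eqF//=; apply/andP; split; rewrite gt_eqF//.
move: t0 s0 s1; set t := n%:R^-1; set u := s i => /andP[t0 tu] u0 u1.
have E1 : (1 + t - u) / (1 + t + u) = 1 - 2 * u / (1 + t + u).
  by field; rewrite gt_eqF//; lra.
have q1 : 2 * u / (1 + t + u) <= 2 * u.
  by rewrite ler_pdivrMr; nra.
have q2 : 2 * u - 4 * u ^+ 2 <= 2 * u / (1 + t + u).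
  by rewrite ler_pdivlMr; nra.
have x1 : 1 - 2 * u <= expR (- (2 * u)) by exact: expR_ge1Dx.
have x2 : expR (- (2 * u)) <= 1 - 2 * u + 4 * u ^+ 2.
  apply: le_trans (expRN_le_inv _) _; first lra.
  rewrite -[leLHS]mul1r ler_pdivrMr; nra.
by rewrite E1 ler_norml; apply/andP; split; lra.
Qed.

(** In terms of [z = j i / rt] one has [s i = (z + 1 / rt) / rt] and [g i <= 1 / (1 + z ^+ 2 / 4)],
    and [z + 1 <= 4 + z ^+ 2]. *)
Let sg_le i : s i * g i <= 4 / rt.
Proof.
have z0 : 0 <= j i / rt by rewrite divr_ge0// ltW.
have gi : g i <= (1 + (j i / rt) ^+ 2 / 4)^-1.
  apply: le_trans (expRN_le_inv _); last by rewrite divr_ge0 ?sqr_ge0// mulr_ge0// ltW.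
  rewrite /g ler_expR lerN2 expr_div_n rtE le_eqVlt; apply/orP; left; apply/eqP.
  by field; rewrite gt_eqF.
have si : s i = (j i / rt + rt^-1) / rt.
  by rewrite /s -rtE; field; rewrite gt_eqF.
have r1 : rt^-1 <= 1 by rewrite invf_le1.
apply: (le_trans (ler_wpM2l (s_ge0 i) gi)).
rewrite si mulrAC ler_wpM2r ?invr_ge0 ?(ltW rt0)//.
move: z0; set z := j i / rt => z0.
rewrite ler_pdivrMr; nra.
Qed.

(** One step adds at most [4 s^2 g^2] to the error, by [ratio_close] and [G_le]; by [sg_le] this is
    at most [16 / rt * (s * g)]. Meanwhile the term [32 / rt * g] loses
    [32 / rt * g * (1 - expR (- s))], at least [16 / rt * (s * g)]. The sum therefore never
    increases, and at the centre it is at most [2 / rt + 32 / rt]. *)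
Let center_error i : (i <= h)%N -> `|B i - G i| + 32 / rt * g i <= 34 / rt.
Proof.
have g1 k : g k <= 1.
  by rewrite /g -expR0 ler_expR oppr_le0 divr_ge0 ?sqr_ge0// mulr_ge0// ltW.
have r0 : 0 < rt^-1 by rewrite invr_gt0.
elim: i => [_|i IH ih].
  have := B0; have := g1 0; nra.
apply: le_trans (IH (ltnW ih)).
have s0 := s_ge0 i; have s1 := s_le1 ih; have sg := sg_le i; have Gg := G_le i.
have rc := ratio_close ih.
have gi0 : 0 < g i by exact: expR_gt0.
(* The ratio is at most 1, so the error inherited from the previous step is not amplified. *)
have th1 : `|(h - i)%:R / (n - h + i.+1)%:R| <= 1 :> R.
  rewrite ger0_norm ?divr_ge0// ler_pdivrMr ?ltr0n ?mul1r ?ler_nat ?addnS//.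
  by rewrite /h; clear; lia.
rewrite ratio_B// ratio_G ratio_g.
move: rc th1; set th := _ / _; set et := expR (- (2 * s i)) => rc th1.
have G0 : 0 <= G i by rewrite GE mulr_ge0 ?expR_ge0.
have -> : th * B i - G i * et = th * (B i - G i) + (th - et) * G i by ring.
have es : expR (- s i) <= 1 - s i / 2.
  apply: le_trans (expRN_le_inv s0) _.
  rewrite -[leLHS]mul1r ler_pdivrMr; nra.
have T1 : `|th * (B i - G i)| <= `|B i - G i| by rewrite normrM ler_piMl.
have T2 : `|(th - et) * G i| <= 4 * s i ^+ 2 * g i ^+ 2.
  by rewrite normrM (ger0_norm G0) ler_pM.
have T3 : 4 * s i ^+ 2 * g i ^+ 2 <= 16 / rt * (s i * g i).
  have : 0 <= s i * g i by rewrite mulr_ge0// ltW.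
  nra.
have T4 : 32 / rt * (g i * expR (- s i)) <= 32 / rt * (g i * (1 - s i / 2)).
  by rewrite ler_wpM2l ?mulr_ge0 ?(ltW r0)// ler_wpM2l// ltW.
have := ler_normD (th * (B i - G i)) ((th - et) * G i).
lra.
Qed.

Lemma local_clt_lower k : (k <= n./2)%N ->
  `|rt * bin_half n k - 2 * phi ((n%:R - 2 * k%:R) / rt)| <= 34 / rt.
Proof.
move=> kh; have := @center_error (h - k) (leq_subr _ _).
have -> : B (h - k) = rt * bin_half n k by rewrite /B subKn.
have -> : G (h - k) = 2 * phi ((n%:R - 2 * k%:R) / rt).
  rewrite /G /j; congr (2 * phi (_ / rt)); apply/eqP.
  rewrite eq_sym subr_eq -[2]/(2%:R) -natrM -natrD eqr_nat.
  rewrite /h in kh *; lia.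
apply: le_trans; rewrite lerDl mulr_ge0 ?divr_ge0 ?(ltW rt0)//.
exact: expR_ge0.
Qed.

End ratio.

Lemma normal_pdf01N x : phi (- x) = phi x.
Proof. by rewrite !normal_pdf01E sqrrN. Qed.

Lemma local_clt (n k : nat) : (0 < n)%N -> (k <= n)%N ->
  `|Num.sqrt n%:R * bin_half n k - 2 * phi ((n%:R - 2 * k%:R) / Num.sqrt n%:R)|
    <= 34 / Num.sqrt n%:R.
Proof.
move=> n0 kn; have [kh|kh] := leqP k n./2; first exact: local_clt_lower.
have kh' : (n - k <= n./2)%N by lia.
have := local_clt_lower n0 kh'.
rewrite /bin_half bin_sub// natrB//.
have -> : n%:R - 2 * (n%:R - k%:R) = - (n%:R - 2 * k%:R) :> R by ring.
by rewrite mulNr normal_pdf01N.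
Qed.

End local_clt.

(** * Decay of the density and summability of its Fourier transform *)

Section density_transfer.
Context d (T : measurableType d) (R : realType) (P : probability T R).
Variables (X : {RV P >-> R}) (p : R -> R).
Hypothesis dX : is_density P X p.
Notation mu := (@lebesgue_measure R).

Let mp : measurable_fun setT p. Proof. by case: dX. Qed.
Let p0 x : 0 <= p x. Proof. by case: dX. Qed.
Let mEp (D : set R) : measurable_fun D (EFin \o p).
Proof. exact/measurable_funTS/measurable_EFinP. Qed.

Lemma density_integral1 : (\int[mu]_x (p x)%:E = 1)%E.
Proof. by case: dX => _ _ <-//; rewrite preimage_setT probability_setT. Qed.

Lemma density_integrable : mu.-integrable setT (EFin \o p).
Proof.
apply/integrableP; split; first exact: mEp.
under eq_integral do rewrite gee0_abs ?lee_fin//.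
by rewrite density_integral1 ltry.
Qed.

(** The law of [X] is dominated by Lebesgue measure, and its Radon-Nikodym derivative has the same
    integral as [p] over every measurable set; the two functions thus agree almost everywhere. *)
Lemma ge0_integral_density (f : R -> \bar R) :
  measurable_fun setT f -> (forall x, (0 <= f x)%E) ->
  (\int[P]_w f (X w) = \int[mu]_x (f x * (p x)%:E))%E.
Proof.
move=> mf f0.
have mX : measurable_fun setT (X : T -> measurableTypeR R).
  exact: (measurable_funP X).
pose X' : {mfun T >-> measurableTypeR R} :=
  HB.pack (X : T -> measurableTypeR R) (isMeasurableFun.Build _ _ _ _ _ mX).
pose nu : probability (measurableTypeR R) R := distribution P X'.
have nuE A : measurable A -> nu A = (\int[mu]_(x in A) (p x)%:E)%E.
  by case: dX => _ _ H mA; exact: H.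
have dom : nu `<< mu.
  apply/null_content_dominatesP => A mA A0.
  rewrite nuE//; by apply: null_set_integral => //; exact: mEp.
rewrite -[LHS](ge0_integral_distribution X' mf f0) -/nu.
have [g [ig Ig ->]] : exists g : R -> \bar R, [/\ mu.-integrable setT g,
    forall E, measurable E -> nu E = (\int[mu]_(x in E) g x)%E &
    (\int[nu]_x f x = \int[mu]_x (f x * g x))%E].
  exists (Radon_Nikodym_SigmaFinite.f nu mu); split.
  - exact: Radon_Nikodym_SigmaFinite.f_integrable.
  - by move=> E mE; exact: (Radon_Nikodym_SigmaFinite.f_integral dom).
  - by rewrite (Radon_Nikodym_SigmaFinite.change_of_variables dom).
have mg := measurable_int _ ig.
apply: ae_eq_integral => //.
- exact: emeasurable_funM.
- by apply: emeasurable_funM => //; exact: mEp.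
- apply: ae_eqe_mul2l; apply: integral_ae_eq => //.
  + exact: mEp.
  + by move=> E _ mE; rewrite -Ig// nuE.
Qed.

(** The nonnegative case is applied to [1 + f], and the total mass 1 is then subtracted from both
    sides. *)
Lemma expectation_density (f : R -> R) : measurable_fun setT f ->
  (forall x, `|f x| <= 1) ->
  fine 'E_P[f \o X] = \int[mu]_x (f x * p x).
Proof.
move=> mf f1.
have fpos x : 0 <= 1 + f x by have := f1 x; rewrite ler_norml; lra.
have ifX : P.-integrable setT (EFin \o (f \o X)).
  apply: (@le_integrable _ _ _ _ _ measurableT _ (fun=> 1%:E)) => //.
  - apply/measurable_EFinP; exact: measurableT_comp.
  - by move=> w _; rewrite /= lee_fin normr1 f1.
  - exact: finite_measure_integrable_cst.
have ifp : mu.-integrable setT (EFin \o (fun x => f x * p x)).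
  apply: le_integrable density_integrable => //.
  - by apply/measurable_EFinP; exact: measurable_funM.
  - by move=> w _; rewrite /= lee_fin normrM ler_piMl.
have := @ge0_integral_density (fun x => (1 + f x)%:E).
under eq_integral do rewrite EFinD.
rewrite integralD//; last exact: finite_measure_integrable_cst.
rewrite integral_cst//= probability_setT mule1.
have -> : (\int[mu]_x ((1 + f x)%:E * (p x)%:E) = 1 + \int[mu]_x (f x * p x)%:E)%E.
  rewrite -density_integral1 -integralD//; last exact: density_integrable.
  by apply: eq_integral => x _; rewrite -EFinM mulrDl mul1r EFinD.
move=> H; rewrite unlock /Rintegral; congr fine.
rewrite -[LHS](@addeK R 1%:E)// -[RHS](@addeK R 1%:E)//.
rewrite [X in (X - _)%E = _]addeC [X in _ = (X - _)%E]addeC H//.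
by apply/measurable_EFinP; exact: measurable_funD.
Qed.

End density_transfer.

(** * Cosine and sine transforms and their derivatives *)

Section trigonometric_transforms.
Context {R : realType}.
Notation mu := (@lebesgue_measure R).
Implicit Types (q : R -> R) (t : R).

Definition cosT q t : R := \int[mu]_x (cos (t * x) * q x).
Definition sinT q t : R := \int[mu]_x (sin (t * x) * q x).

Lemma measurable_cosM t : measurable_fun setT (fun x : R => cos (t * x)).
Proof.
apply: (measurableT_comp (continuous_measurable_fun (@continuous_cos R))).
exact: measurable_funM.
Qed.

Lemma measurable_sinM t : measurable_fun setT (fun x : R => sin (t * x)).
Proof.
apply: (measurableT_comp (continuous_measurable_fun (@continuous_sin R))).
exact: measurable_funM.
Qed.

Lemma cos_norm_le1 (x : R) : `|cos x| <= 1.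
Proof. by rewrite ler_norml cos_geN1 cos_le1. Qed.

Lemma sin_norm_le1 (x : R) : `|sin x| <= 1.
Proof. by rewrite ler_norml sin_geN1 sin_le1. Qed.

Lemma integrable_bounded_mul (h q : R -> R) : measurable_fun setT h ->
  (forall x, `|h x| <= 1) -> mu.-integrable setT (EFin \o q) ->
  mu.-integrable setT (EFin \o (fun x => h x * q x)).
Proof.
move=> mh h1 iq; have mq := measurable_int _ iq; apply: le_integrable iq => //.
- by apply/measurable_EFinP; apply: measurable_funM => //; exact/measurable_EFinP.
- by move=> x _; rewrite /= lee_fin normrM ler_piMl.
Qed.

Lemma integrable_cosT q t : mu.-integrable setT (EFin \o q) ->
  mu.-integrable setT (EFin \o (fun x => cos (t * x) * q x)).
Proof.
by apply: integrable_bounded_mul => [|x]; [exact: measurable_cosM|exact: cos_norm_le1].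
Qed.

Lemma integrable_sinT q t : mu.-integrable setT (EFin \o q) ->
  mu.-integrable setT (EFin \o (fun x => sin (t * x) * q x)).
Proof.
by apply: integrable_bounded_mul => [|x]; [exact: measurable_sinM|exact: sin_norm_le1].
Qed.

Lemma is_derive_cosMl (x t : R) : is_derive t 1 (fun s => cos (s * x)) (- (sin (t * x) * x)).
Proof.
have d1 : is_derive t 1 (fun s : R => s * x) x.
  have : is_derive t 1 (id * cst x : R -> R) x.
    by apply: is_derive_eq; rewrite scaler0 add0r /GRing.scale/= mulr1.
  by [].
have := @is_derive1_comp _ cos ( *%R^~ x) t _ _ (is_derive_cos (t * x)) d1.
by rewrite mulNr.
Qed.

Lemma is_derive_sinMl (x t : R) : is_derive t 1 (fun s => sin (s * x)) (cos (t * x) * x).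
Proof.
have d1 : is_derive t 1 (fun s : R => s * x) x.
  have : is_derive t 1 (id * cst x : R -> R) x.
    by apply: is_derive_eq; rewrite scaler0 add0r /GRing.scale/= mulr1.
  by [].
exact: (@is_derive1_comp _ sin ( *%R^~ x) t _ _ (is_derive_sin (t * x)) d1).
Qed.

Lemma is_derive_Mr (f : R -> R) (c t f' : R) : is_derive t 1 f f' ->
  is_derive t 1 (fun s => f s * c) (f' * c).
Proof.
move=> df; have : is_derive t 1 (f * cst c : R -> R) (f' * c).
  by apply: is_derive_eq; rewrite scaler0 add0r /GRing.scale/= mulrC.
by [].
Qed.

Section differentiate.
Variable q : R -> R.
Hypothesis iq : mu.-integrable setT (EFin \o q).
Hypothesis ixq : mu.-integrable setT (EFin \o (fun x => x * q x)).

Let iabs : mu.-integrable setT (EFin \o (fun x => `|x * q x|)).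
Proof. exact: integrable_norm ixq. Qed.

(** Differentiation under the integral sign near [t]: the derivative of the integrand in the
    parameter is dominated by [|x * q x|] whatever the parameter. *)
Lemma is_derive_cosT t : is_derive t 1 (cosT q) (- sinT (fun x => x * q x) t).
Proof.
have tI : `]t - 1, t + 1[%classic t by rewrite /= in_itv/=; lra.
have D (s x : R) : is_derive s 1 (fun s => cos (s * x) * q x) (- (sin (s * x) * x) * q x).
  by apply: is_derive_Mr; exact: is_derive_cosMl.
have E s x : partial1of2 (fun s x => cos (s * x) * q x) s x = - (sin (s * x) * (x * q x)).
  rewrite partial1of2E; have [_ ->] := D s x; ring.
have h1 s : `]t - 1, t + 1[%classic s ->
  mu.-integrable setT (EFin \o (fun x => cos (s * x) * q x)).
  by move=> _; exact: integrable_cosT.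
have h2 (s x : R) : `]t - 1, t + 1[%classic s -> setT x -> derivable (fun s : R => cos (s * x) * q x) s 1.
  by move=> _ _; case: (D s x).
have h3 s x : `]t - 1, t + 1[%classic s -> setT x ->
  `|partial1of2 (fun s x => cos (s * x) * q x) s x| <= `|x * q x|.
  by move=> _ _; rewrite E normrN normrM ler_piMl// sin_norm_le1.
apply: DeriveDef.
  exact: (derivable_under_integral measurableT tI h1 h2 (fun=> normr_ge0 _) iabs h3).
rewrite -derive1E (differentiation_under_integral measurableT tI h1 h2 (fun=> normr_ge0 _) iabs h3).
under eq_Rintegral do rewrite E -mulN1r.
by rewrite RintegralZl ?mulN1r//; exact: integrable_sinT.
Qed.

Lemma is_derive_sinT t : is_derive t 1 (sinT q) (cosT (fun x => x * q x) t).
Proof.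
have tI : `]t - 1, t + 1[%classic t by rewrite /= in_itv/=; lra.
have D (s x : R) : is_derive s 1 (fun s => sin (s * x) * q x) (cos (s * x) * x * q x).
  by apply: is_derive_Mr; exact: is_derive_sinMl.
have E s x : partial1of2 (fun s x => sin (s * x) * q x) s x = cos (s * x) * (x * q x).
  rewrite partial1of2E; have [_ ->] := D s x; ring.
have h1 s : `]t - 1, t + 1[%classic s ->
  mu.-integrable setT (EFin \o (fun x => sin (s * x) * q x)).
  by move=> _; exact: integrable_sinT.
have h2 (s x : R) : `]t - 1, t + 1[%classic s -> setT x -> derivable (fun s : R => sin (s * x) * q x) s 1.
  by move=> _ _; case: (D s x).
have h3 s x : `]t - 1, t + 1[%classic s -> setT x ->
  `|partial1of2 (fun s x => sin (s * x) * q x) s x| <= `|x * q x|.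
  by move=> _ _; rewrite E normrM ler_piMl// cos_norm_le1.
apply: DeriveDef.
  exact: (derivable_under_integral measurableT tI h1 h2 (fun=> normr_ge0 _) iabs h3).
rewrite -derive1E (differentiation_under_integral measurableT tI h1 h2 (fun=> normr_ge0 _) iabs h3).
by under eq_Rintegral do rewrite E.
Qed.

Lemma continuous_cosT : continuous (cosT q).
Proof.
by move=> t; apply: differentiable_continuous; apply/derivable1_diffP; case: (is_derive_cosT t).
Qed.

Lemma continuous_sinT : continuous (sinT q).
Proof.
by move=> t; apply: differentiable_continuous; apply/derivable1_diffP; case: (is_derive_sinT t).
Qed.

End differentiate.

End trigonometric_transforms.

(** * Pointwise bound of a nonnegative function by its integrable transform *)

Section fourier_bound.
Context {R : realType}.
Notation mu := (@lebesgue_measure R).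

Lemma is_derive_tent_sin (T v t : R) : T != 0 -> v != 0 ->
  is_derive t 1 (fun t => (1 - t / T) * (sin (t * v) / v) - cos (t * v) / (T * v ^+ 2))
    ((1 - t / T) * cos (t * v)).
Proof.
move=> T0 v0.
have d1 : is_derive t 1 (fun t : R => 1 - t / T) (- T^-1).
  have : is_derive t 1 (cst 1 - id * cst T^-1 : R -> R) (- T^-1).
    by apply: is_derive_eq; rewrite scaler0 !add0r /GRing.scale/= mulr1.
  by [].
have d2 := is_derive_Mr v^-1 (is_derive_sinMl v t).
have d3 := is_derive_Mr (T * v ^+ 2)^-1 (is_derive_cosMl v t).
have := is_deriveB (is_deriveM d1 d2) d3.
move=> d; apply: (is_derive_eq d); rewrite /GRing.scale/=.
by field; rewrite v0 T0.
Qed.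

Lemma continuous_tent_cos (T v : R) : continuous (fun t : R => (1 - t / T) * cos (t * v)).
Proof.
move=> t; apply: cvgM.
  by apply: cvgB; [exact: cvg_cst|apply: cvgM; [exact: cvg_id|exact: cvg_cst]].
apply: differentiable_continuous; apply/derivable1_diffP.
by case: (is_derive_cosMl v t).
Qed.

(* Being nonnegative, and large near 0, this kernel bounds [g x] by the integral
   of the Fourier transform of [g] without Fourier inversion. *)
Definition tent_kernel (T v : R) : R := \int[mu]_(t in `[0, T]) ((1 - t / T) * cos (t * v)).

(** The antiderivative evaluates the kernel to [(1 - cos (T * v)) / (T * v ^+ 2)], the Fejer kernel
    of the real line. *)
Lemma tent_kernel_ge0 (T v : R) : 0 < T -> v != 0 -> 0 <= tent_kernel T v.
Proof.
move=> T0 v0.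
rewrite /tent_kernel (integral_of_derivative (ltW T0)
  (fun t => is_derive_tent_sin t (lt0r_neq0 T0) v0)); last exact: continuous_tent_cos.
rewrite divff ?gt_eqF// subrr mul0r sub0r !mul0r sin0 cos0 mul0r mulr0 sub0r opprK addrC.
by rewrite -mulrBl divr_ge0 ?subr_ge0 ?cos_le1// mulr_ge0 ?(ltW T0)// sqr_ge0.
Qed.

(** For [t] in [[0, T]] the argument [t * v] stays within [[-1, 1]], where the cosine is at least
    [cos 1]; the remaining integral of [1 - t / T] is [T / 2]. *)
Lemma tent_kernel_ge (T v : R) : 0 < T -> `|v| <= T^-1 ->
  cos 1 * (T / 2) <= tent_kernel T v.
Proof.
move=> T0 vT.
have d1 (t : R) : is_derive t 1 (fun t : R => cos 1 * (t - t ^+ 2 / (2 * T))) (cos 1 * (1 - t / T)).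
  have : is_derive t 1 (cst (cos 1) * (id - id ^+ 2 * cst (2 * T)^-1) : R -> R) (cos 1 * (1 - t / T)).
    apply: is_derive_eq; rewrite /GRing.scale/= !mulr1 !mulr0 !add0r addr0 expr1.
    by congr (_ * _); field; rewrite gt_eqF.
  by [].
have c1 : continuous (fun t : R => cos 1 * (1 - t / T)).
  move=> t; apply: cvgM; first exact: cvg_cst.
  by apply: cvgB; [exact: cvg_cst|apply: cvgM; [exact: cvg_id|exact: cvg_cst]].
have <- : \int[mu]_(t in `[0, T]) (cos 1 * (1 - t / T)) = cos 1 * (T / 2).
  rewrite (integral_of_derivative (ltW T0) d1)// expr0n mul0r subr0 mulr0 subr0.
  by congr (_ * _); field; rewrite gt_eqF.
apply: le_Rintegral => //.
- exact: continuous_integrable_itv.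
- by apply: continuous_integrable_itv; exact: continuous_tent_cos.
- move=> t /=; rewrite in_itv/= => /andP[t0 tT].
  rewrite mulrC ler_wpM2l//; first by rewrite subr_ge0 ler_pdivrMr ?mul1r.
  have tv : `|t * v| <= 1.
    rewrite normrM (ger0_norm t0) (le_trans (ler_pM _ _ tT vT))//.
    by rewrite divff// gt_eqF.
  have -> : cos (t * v) = cos `|t * v|.
    by case: (ger0P (t * v)) => // _; rewrite cosN.
  have p2 := pi_ge2 R.
  rewrite leNgt; apply/negP; rewrite ltr_cos ?in_itv/= ?normr_ge0 ?ler01//=; last 2 first.
  + by rewrite (le_trans _ p2)// ler1n.
  + by rewrite (le_trans tv)// (le_trans _ p2)// ler1n.
  by apply/negP; rewrite -leNgt.
Qed.

Section bound.
Variable g : R -> R.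
Hypothesis g0 : forall x, 0 <= g x.
Hypothesis cg : continuous g.
Hypothesis ig : mu.-integrable setT (EFin \o g).
Hypothesis ic : mu.-integrable setT (EFin \o cosT g).
Hypothesis is_ : mu.-integrable setT (EFin \o sinT g).

Let mg : measurable_fun setT g.
Proof. by have := measurable_int _ ig => /measurable_EFinP. Qed.

Let K := \int[mu]_t (`|cosT g t| + `|sinT g t|).

(** The tent is extended by zero so that Fubini applies on the product of two full lines. *)
Let tent (T : R) (t : R) : R := (1 - t / T) * \1_`[0, T] t.

Let tent_bd (T t : R) : 0 < T -> 0 <= tent T t <= \1_`[0, T] t.
Proof.
move=> T0; rewrite /tent indicE; case: (boolP (t \in _)); rewrite ?mulr0 ?lexx// mulr1.
rewrite inE/= in_itv/= => /andP[t0 tT].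
by rewrite subr_ge0 ler_pdivrMr ?mul1r ?tT//= lerBlDr lerDl divr_ge0// ltW.
Qed.

Let mtent T : measurable_fun setT (tent T).
Proof.
apply: measurable_funM; last exact: measurable_indic.
by apply: measurable_funB => //; exact: measurable_funM.
Qed.

Let kernel2 (T x : R) (z : R * R) : R := tent T z.1 * (cos (z.1 * (z.2 - x)) * g z.2).

Let mkernel2 T x : measurable_fun setT (kernel2 T x).
Proof.
apply: measurable_funM.
  exact: (measurableT_comp (mtent T)).
apply: measurable_funM; last exact: measurableT_comp.
apply: (measurableT_comp (continuous_measurable_fun (@continuous_cos R))).
apply: measurable_funM; first exact: measurable_fst.
by apply: measurable_funB => //; exact: measurable_snd.
Qed.

Let int_shift_cos (t x : R) : \int[mu]_y (cos (t * (y - x)) * g y) =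
  cos (t * x) * cosT g t + sin (t * x) * sinT g t.
Proof.
rewrite /cosT /sinT -!RintegralZl//; [|exact: integrable_sinT|exact: integrable_cosT].
rewrite -RintegralD//.
- apply: eq_Rintegral => y _; rewrite mulrBr cosD cosN sinN; ring.
- by apply: integrable_bounded_mul (integrable_cosT t ig) => // _; exact: cos_norm_le1.
- by apply: integrable_bounded_mul (integrable_sinT t ig) => // _; exact: sin_norm_le1.
Qed.

Let tent_kernel_ge0' T v : 0 < T -> 0 <= tent_kernel T v.
Proof.
move=> T0; have [->|v0] := eqVneq v 0; last exact: tent_kernel_ge0.
apply: le_trans (tent_kernel_ge T0 _); last by rewrite normr0 invr_ge0 ltW.
by rewrite mulr_ge0 ?divr_ge0 ?(ltW T0)// ltW// cos1_gt0.
Qed.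

Let integrable_kernel2 T x : 0 < T ->
  (mu \x mu)%E.-integrable setT (EFin \o kernel2 T x).
Proof.
move=> T0.
have mk : measurable_fun setT (EFin \o kernel2 T x).
  by apply/measurable_EFinP; exact: mkernel2.
apply/integrable12ltyP => //.
apply: (@le_lt_trans _ _ (\int[mu]_t ((\1_`[0, T] t)%:E * \int[mu]_y (g y)%:E))%E).
  apply: ge0_le_integral => //.
  - by move=> t _; apply: integral_ge0.
  - apply: (@measurable_fun_fubini_tonelli_F _ _ (measurableTypeR R) (measurableTypeR R) R mu
      (abse \o (EFin \o kernel2 T x))) => //.
    exact: measurableT_comp.
    by move=> z; exact: abse_ge0.
  - apply: emeasurable_funM; last exact: measurable_cst.
    by apply/measurable_EFinP; exact: measurable_indic.
  - move=> t _; rewrite -ge0_integralZl//; last 2 first.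
    + exact/measurable_EFinP.
    + by move=> y _; rewrite lee_fin.
    apply: ge0_le_integral => //.
    + apply/measurableT_comp => //; apply/measurable_EFinP.
      rewrite /kernel2/=; move: (tent T t) => c; apply: measurable_funM => //.
      apply: measurable_funM => //; apply: (measurableT_comp (continuous_measurable_fun (@continuous_cos R))).
      by apply: measurable_funM => //; exact: measurable_funB.
    + apply/measurable_EFinP; exact: measurable_funM.
    + move=> y _; rewrite -EFinM lee_fin /kernel2/=.
      move: (tent_bd t T0); move: (tent T t) => c /andP[t0 t1].
      rewrite !normrM (ger0_norm (g0 y)) (ger0_norm t0) mulrA ler_wpM2r//.
      by rewrite (le_trans _ t1)// ler_piMr// cos_norm_le1.
rewrite (EFin_Rintegral measurableT ig) ge0_integralZr//; last 2 first.
- by apply/measurable_EFinP; exact: measurable_indic.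
- by rewrite lee_fin Rintegral_ge0.
by rewrite integral_indic//= setIT lebesgue_measure_itv/= lte_fin T0 -EFinD -EFinM ltry.
Qed.

Let kernel_inner T x y : 0 < T ->
  (\int[mu]_t (EFin \o kernel2 T x) (t, y) = (tent_kernel T (y - x) * g y)%:E)%E.
Proof.
move=> T0.
transitivity (\int[mu]_t (((1 - t / T) * cos (t * (y - x)))%:E * (\1_`[0, T] t)%:E * (g y)%:E))%E.
  by apply: eq_integral => t _; rewrite /= /kernel2/= /tent -!EFinM; congr EFin; ring.
have i2 : mu.-integrable `[0, T] (EFin \o (fun t => (1 - t / T) * cos (t * (y - x)))).
  by apply: continuous_integrable_itv; exact: continuous_tent_cos.
rewrite integralZr//; last first.
  have /integrable_mkcond i3 := i2.
  rewrite (_ : (fun _ => _) = (EFin \o (fun t => (1 - t / T) * cos (t * (y - x)))) \_ `[0, T]).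
    exact: i3.
  by apply/funext => t; rewrite epatch_indic.
rewrite EFinM; congr (_ * _)%E.
rewrite /tent_kernel -[RHS]EFin_Rintegral// [RHS]integral_mkcond.
apply: eq_integral => t _.
by rewrite epatch_indic.
Qed.

(** Fubini moves the kernel from [g] to its transforms. Since [0 <= tent <= 1], the right-hand side
    is at most [K], independently of [T]. *)
Let kernel_identity T x : 0 < T ->
  (\int[mu]_y (tent_kernel T (y - x) * g y)%:E =
   \int[mu]_t (tent T t * (cos (t * x) * cosT g t + sin (t * x) * sinT g t))%:E)%E.
Proof.
move=> T0; have := Fubini (integrable_kernel2 x T0).
have -> : (fun t => \int[mu]_y (EFin \o kernel2 T x) (t, y))%E =
    (fun t => (tent T t * (cos (t * x) * cosT g t + sin (t * x) * sinT g t))%:E).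
  apply/funext => t; have i1 : mu.-integrable setT (EFin \o (fun y => cos (t * (y - x)) * g y)).
    apply: integrable_bounded_mul => //; last by move=> ?; exact: cos_norm_le1.
    apply: (measurableT_comp (continuous_measurable_fun (@continuous_cos R))).
    by apply: measurable_funM => //; exact: measurable_funB.
  rewrite -int_shift_cos -RintegralZl// -EFin_Rintegral//.
  rewrite (_ : EFin \o _ = fun y => (tent T t)%:E * (cos (t * (y - x)) * g y)%:E)%E//.
  exact: integrableZl.
by move=> ->; apply: eq_integral => y _; rewrite kernel_inner.
Qed.

(** By continuity [g] exceeds [g x / 2] on an interval of radius [1 / T] around [x], for some [T].
    There the kernel is at least [cos 1 * T / 2], and the length [2 / T] cancels [T]: the left side
    of [kernel_identity] is at least [cos 1 * g x / 2], while the right side is at most [K]. *)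
Lemma fourier_bounded x : g x <= 2 / cos 1 * K.
Proof.
have c1 := cos1_gt0 R.
have K0 : 0 <= K by apply: Rintegral_ge0 => t _; rewrite addr_ge0.
have [->|gx0] := eqVneq (g x) 0; first by rewrite !mulr_ge0// invr_ge0 ltW.
have gx : 0 < g x by rewrite lt_neqAle eq_sym gx0 g0.
have gx2 : g x / 2 < g x by rewrite ltr_pdivrMr// ltr_pMr// ltr1n.
have near_x : \forall y \near x, g x / 2 < g y by exact: cvgr_gt (@cg x) _ gx2.
have [e /= e0 ge] := (nbhs_ballP _ _).1 near_x.
(* Half the radius, because the closed interval of radius [dl] must lie in the open ball. *)
pose dl := e / 2; have dl0 : 0 < dl by rewrite divr_gt0.
have T0 : 0 < dl^-1 by rewrite invr_gt0.
have mG : measurable_fun [set: measurableTypeR R]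
    (fun y : R => (tent_kernel dl^-1 (y - x) * g y)%:E).
  have := measurable_fubini_G (integrable_kernel2 x T0); congr measurable_fun.
  by apply/funext => y; exact: kernel_inner.
have lo : ((cos 1 * (g x / 2))%:E <=
    \int[mu]_y (tent_kernel dl^-1 (y - x) * g y)%:E)%E.
  pose I : set (measurableTypeR R) := [set` `[x - dl, x + dl]].
  have mI : measurable I by exact: measurable_itv.
  apply: (@le_trans _ _ (\int[mu]_(y in I) (tent_kernel dl^-1 (y - x) * g y)%:E)%E); last first.
    apply: ge0_subset_integral => //= y _; rewrite lee_fin mulr_ge0//.
    exact: tent_kernel_ge0'.
  apply: (@le_trans _ _ (\int[mu]_(y in I) (cos 1 * (dl^-1 / 2) * (g x / 2))%:E)%E).
    rewrite integral_cst//= lebesgue_measure_itv/= lte_fin.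
    rewrite ltrD2l gt0_cp// -EFinD -EFinM lee_fin le_eqVlt; apply/orP; left; apply/eqP.
    by field; rewrite gt_eqF.
  apply: ge0_le_integral => //.
  - by move=> y _; rewrite lee_fin !mulr_ge0 ?divr_ge0 ?invr_ge0// ltW.
  - exact: measurable_funTS.
  - move=> y; rewrite /I/= in_itv/= => /andP[y1 y2].
    have yx : `|y - x| <= dl by rewrite ler_norml; lra.
    have k1 : cos 1 * (dl^-1 / 2) <= tent_kernel dl^-1 (y - x).
      by apply: tent_kernel_ge; rewrite ?invrK.
    have k2 : g x / 2 < g y.
      by apply: ge; rewrite /ball/= distrC (le_lt_trans yx)// /dl; lra.
    rewrite lee_fin; apply: ler_pM => //; last exact: ltW.
      by rewrite !mulr_ge0 ?invr_ge0// ltW.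
    by rewrite divr_ge0// ltW.
rewrite kernel_identity// in lo.
have iK : mu.-integrable setT (EFin \o (fun t => `|cosT g t| + `|sinT g t|)).
  rewrite (_ : _ \o _ = (fun t => (`|cosT g t|)%:E + (`|sinT g t|)%:E)%E)//.
  by apply: integrableD => //; exact: integrable_norm.
have up : (\int[mu]_t (tent dl^-1 t * (cos (t * x) * cosT g t + sin (t * x) * sinT g t))%:E <= K%:E)%E.
  rewrite -EFin_Rintegral//.
  have mc : measurable_fun setT (cosT g) by have := measurable_int _ ic => /measurable_EFinP.
  have ms : measurable_fun setT (sinT g) by have := measurable_int _ is_ => /measurable_EFinP.
  have B t : `|tent dl^-1 t * (cos (t * x) * cosT g t + sin (t * x) * sinT g t)|
      <= `|cosT g t| + `|sinT g t|.
    have /andP[t0 t1] := tent_bd t T0.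
    rewrite normrM (ger0_norm t0) (le_trans (ler_piMl _ _))//.
      by rewrite (le_trans t1)// indicE; case: (_ \in _).
    by rewrite (le_trans (ler_normD _ _))// !normrM lerD// ler_piMl//
      ?cos_norm_le1 ?sin_norm_le1.
  apply: le_integral => //.
  - apply: le_integrable iK => //.
    + apply/measurable_EFinP; apply: measurable_funM; first exact: mtent.
      apply: measurable_funD; apply: measurable_funM => //.
        by under eq_fun do rewrite mulrC; exact: measurable_cosM.
      by under eq_fun do rewrite mulrC; exact: measurable_sinM.
    + by move=> t _; rewrite /= lee_fin (le_trans (B t))// ler_norm.
  - by move=> t _; rewrite lee_fin (le_trans (ler_norm _)).
have := le_trans lo up; rewrite lee_fin => H.
rewrite mulrAC ler_pdivlMr//; lra.
Qed.

End bound.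
End fourier_bound.

(** * Summability of equally spaced samples *)

Section samples.
Context {R : realType}.
Notation mu := (@lebesgue_measure R).

Lemma integrable_normS (f : R -> R) (D : set (measurableTypeR R)) : measurable D ->
  mu.-integrable setT (EFin \o f) -> mu.-integrable D (EFin \o (fun x => `|f x|)).
Proof. by move=> mD intf; apply: (integrableS measurableT) => //; exact: integrable_norm. Qed.

Lemma le_Rintegral_setT (f : R -> R) (D : set (measurableTypeR R)) : measurable D ->
  mu.-integrable setT (EFin \o f) -> (forall x, 0 <= f x) ->
  \int[mu]_(x in D) f x <= \int[mu]_x f x.
Proof.
move=> mD intf f0; have intD := integrableS measurableT mD (@subsetT _ _) intf.
rewrite -lee_fin /Rintegral !fineK ?integrable_fin_num//.
apply: ge0_subset_integral => //; first exact: measurable_int intf.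
by move=> x _; rewrite lee_fin.
Qed.

Lemma Rintegral_itv_cat (f : R -> R) (a b c : R) : a <= b -> b <= c ->
  mu.-integrable setT (EFin \o f) ->
  \int[mu]_(x in `[a, c]) f x = \int[mu]_(x in `[a, b]) f x + \int[mu]_(x in `[b, c]) f x.
Proof.
move=> ab bc intf.
have intI (I : interval R) : mu.-integrable [set` I] (EFin \o f).
  by apply: integrableS intf.
have := @Rintegral_itvB R f (BLeft a) (BRight c) b (intI _).
rewrite !bnd_simp ab bc => /(_ isT isT).
rewrite Rintegral_itv_obnd_cbnd; last first.
  by have /measurable_EFinP := measurable_int _ (intI `]b, c]%O).
by move=> <-; rewrite addrC subrK.
Qed.

Lemma sum_consecutive_integrals (f : R -> R) (h : R) N : 0 <= h ->
  mu.-integrable setT (EFin \o f) ->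
  \sum_(k < N) \int[mu]_(x in `[h * k%:R, h * k.+1%:R]) f x =
  \int[mu]_(x in `[0, h * N%:R]) f x.
Proof.
move=> h0 intf; elim: N => [|N IH].
  by rewrite big_ord0 mulr0 set_itv1 Rintegral_set1.
rewrite big_ord_recr/= IH -Rintegral_itv_cat// ?mulr_ge0//.
by rewrite ler_wpM2l// ler_nat.
Qed.

(** On the cell of length [h] starting at [h * k], the sample exceeds [|u s|] by at most the
    integral of [|u'|] over the cell, for every [s] in it. Averaging over [s] and summing over the
    cells gives the bound. *)
Lemma sum_samples_le (u u' : R -> R) (h : R) N : 0 < h ->
  (forall x : R, is_derive x 1 u (u' x)) -> continuous u' ->
  mu.-integrable setT (EFin \o u) -> mu.-integrable setT (EFin \o u') ->
  \sum_(k < N) `|u (h * k%:R)| <=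
    h^-1 * (\int[mu]_x `|u x|) + \int[mu]_x `|u' x|.
Proof.
move=> h0 du cu' iu iu'.
pose I k := [set` `[h * k%:R, h * k.+1%:R]] : set (measurableTypeR R).
have mI k : measurable (I k) by exact: measurable_itv.
apply: (@le_trans _ _ (\sum_(k < N) (h^-1 * (\int[mu]_(x in I k) `|u x|)
    + \int[mu]_(x in I k) `|u' x|))).
  apply: ler_sum => k _; set a := h * k%:R; set b := h * k.+1%:R.
  have ab : b = a + h by rewrite /a /b -natr1 mulrDr mulr1.
  set D := \int[mu]_(x in I k) `|u' x|.
  have pt s : I k s -> `|u a| <= `|u s| + D.
    rewrite /I/= in_itv/= -/a -/b => /andP[as_ sb].
    have e := integral_of_derivative as_ du cu'.
    have ius : mu.-integrable `[a, s] (EFin \o u') by exact: continuous_integrable_itv.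
    have : `|\int[mu]_(x in `[a, s]) u' x| <= D.
      apply: (le_trans (le_normr_Rintegral _ ius)) => //.
      rewrite -lee_fin /D /Rintegral !fineK ?integrable_fin_num//; last 2 first.
      - exact: integrable_normS.
      - exact: integrable_normS.
      apply: ge0_subset_integral => //.
      - by apply: measurable_int (integrable_normS (mI k) iu').
      - by move=> x; rewrite /I/= !in_itv/= => /andP[-> xs]; rewrite (le_trans xs).
    rewrite e => /= H; have -> : u a = u s - (u s - u a) by ring.
    by rewrite (le_trans (ler_normB _ _))// lerD2l.
  have D0 : 0 <= D by apply: Rintegral_ge0.
  have : \int[mu]_(x in I k) `|u a| <= \int[mu]_(x in I k) (`|u x| + D).
    have icst c : mu.-integrable (I k) (EFin \o cst c : _ -> \bar R).
      by apply: continuous_integrable_itv => x; exact: cvg_cst.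
    apply: le_Rintegral => //; first exact: icst.
    rewrite (_ : _ \o _ = (fun t => (`|u t|)%:E + (EFin \o cst D) t)%E)//.
    by apply: integrableD => //; exact: integrable_normS.
  have icst c : mu.-integrable (I k) (EFin \o cst c : _ -> \bar R).
    by apply: continuous_integrable_itv => x; exact: cvg_cst.
  rewrite RintegralD//; [|exact: integrable_normS|exact: icst].
  have muI : fine (mu (I k)) = h.
    by rewrite lebesgue_measure_itv/= lte_fin -/a -/b ab ltrDl h0 -EFinD/= addrC addKr.
  rewrite !Rintegral_cst// muI => H.
  rewrite -(@ler_pM2r _ h)// mulrDl mulrAC mulVf ?gt_eqF// mul1r.
  by move: H; rewrite mulrC (mulrC D).
rewrite big_split/= -mulr_sumr !sum_consecutive_integrals ?(ltW h0)//; last 2 first.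
- exact: integrable_norm.
- exact: integrable_norm.
by rewrite lerD ?ler_wpM2l ?invr_ge0 ?(ltW h0)//; apply: le_Rintegral_setT => //;
  exact: integrable_norm.
Qed.

End samples.

(** * Decay of the density and summability of the samples of its characteristic function *)

Section charfun_consequences.
Context d (T : measurableType d) (R : realType) (P : probability T R).
Variables (X : {RV P >-> R}) (p : R -> R).
Notation mu := (@lebesgue_measure R).
Hypothesis p_cont : continuous p.
Hypothesis X2 : ('E_P[fun w => (X w ^+ 2)%R] < +oo)%E.
Hypothesis dX : is_density P X p.
Hypothesis if0 : cintegrable (charfun P X).
Hypothesis if1 : cintegrable (cderive1 (charfun P X)).
Hypothesis if2 : cintegrable (cderive1 (cderive1 (charfun P X))).

Let p0 x : 0 <= p x. Proof. by case: dX. Qed.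
Let mp : measurable_fun setT p. Proof. by case: dX. Qed.
Let ip := density_integrable dX.
Let xp x := x * p x.
Let xxp x := x * xp x.

Lemma charfunE : charfun P X = fun t => cosT p t +i* sinT p t.
Proof.
apply/funext => t; rewrite /charfun; congr (_ +i* _).
  apply: (expectation_density dX (measurable_cosM t)) => x; exact: cos_norm_le1.
apply: (expectation_density dX (measurable_sinM t)) => x; exact: sin_norm_le1.
Qed.

Let ixxp : mu.-integrable setT (EFin \o xxp).
Proof.
have xxp0 x : 0 <= xxp x by rewrite /xxp /xp mulrA mulr_ge0// -expr2 sqr_ge0.
apply/integrableP; split.
  by apply/measurable_EFinP; do 2 apply: measurable_funM => //.
under eq_integral do rewrite gee0_abs ?lee_fin//.
move: X2; rewrite unlock.
rewrite (ge0_integral_density dX (f := fun x => (x ^+ 2)%:E)); last 2 first.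
- by apply/measurable_EFinP; exact: measurable_funX.
- by move=> x; rewrite lee_fin sqr_ge0.
by congr (_ < _)%E; apply: eq_integral => x _; rewrite -EFinM expr2 -mulrA.
Qed.

Let ixp : mu.-integrable setT (EFin \o xp).
Proof.
apply: (@le_integrable _ _ _ mu _ measurableT _ (fun x => (EFin \o p) x + (EFin \o xxp) x)%E) => //.
- by apply/measurable_EFinP; exact: measurable_funM.
- move=> x _; rewrite /= lee_fin (@ger0_norm _ (p x + _)); last first.
    by rewrite addr_ge0// /xxp /xp mulrA mulr_ge0// -expr2 sqr_ge0.
  rewrite /xxp /xp normrM (ger0_norm (p0 x)) mulrA -[X in X + _]mul1r -mulrDl ler_wpM2r//.
  by rewrite ler_norml; apply/andP; split; nra.
- exact: integrableD.
Qed.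

Let charfun' : cderive1 (charfun P X) = fun t => - sinT xp t +i* cosT xp t.
Proof.
apply/funext => t; rewrite charfunE /cderive1/=; congr (_ +i* _).
  by rewrite derive1E; case: (is_derive_cosT ip ixp t).
by rewrite derive1E; case: (is_derive_sinT ip ixp t).
Qed.

Let charfun'' : cderive1 (cderive1 (charfun P X)) = fun t => - cosT xxp t +i* - sinT xxp t.
Proof.
apply/funext => t; rewrite charfun' /cderive1/=; congr (_ +i* _).
  rewrite derive1E; case: (is_deriveN (is_derive_sinT ixp ixxp t)) => _ <-//.
by rewrite derive1E; case: (is_derive_cosT ixp ixxp t).
Qed.

Let integrableNK (f : R -> R) : mu.-integrable setT (fun t => (- f t)%:E) ->
  mu.-integrable setT (EFin \o f).
Proof.
move=> /integrableN; apply: eq_integrable => // x _ /=.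
by rewrite opprK.
Qed.

Lemma density_decay : exists K0 : R, forall x, p x <= K0 / (1 + x ^+ 2).
Proof.
have [ic is_] : mu.-integrable setT (EFin \o cosT p) /\
    mu.-integrable setT (EFin \o sinT p).
  by move: if0; rewrite charfunE.
have [ic2 is2] : mu.-integrable setT (EFin \o cosT xxp) /\
    mu.-integrable setT (EFin \o sinT xxp).
  by move: if2; rewrite charfun'' => -[h1 h2]; split; exact: integrableNK.
have xxp0 x : 0 <= xxp x by rewrite /xxp /xp mulrA mulr_ge0// -expr2 sqr_ge0.
have xxpc : continuous xxp.
  by move=> x; apply: cvgM; [exact: cvg_id|apply: cvgM; [exact: cvg_id|exact: p_cont]].
have b0 := fourier_bounded p0 p_cont ip ic is_.
have b2 := fourier_bounded xxp0 xxpc ixxp ic2 is2.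
eexists => x; rewrite ler_pdivlMr; last by rewrite ltr_pwDl// sqr_ge0.
have := lerD (b0 x) (b2 x); apply: le_trans.
by rewrite /xxp /xp; nra.
Qed.

(** Nonnegative indices are enough: [cosT p] is even and [sinT p] is odd. *)
Lemma charfun_samples_bounded : exists M : R, forall N,
  \sum_(k < N) (`|cosT p (pi * k%:R)| + `|sinT p (pi * k%:R)|) <= M.
Proof.
have [ic is_] : mu.-integrable setT (EFin \o cosT p) /\
    mu.-integrable setT (EFin \o sinT p).
  by move: if0; rewrite charfunE.
have [is1 ic1] : mu.-integrable setT (EFin \o sinT xp) /\
    mu.-integrable setT (EFin \o cosT xp).
  by move: if1; rewrite charfun' => -[h1 h2]; split; first exact: integrableNK.
have is1' : mu.-integrable setT (EFin \o (fun t => - sinT xp t)).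
  by have := integrableN is1; apply: eq_integrable.
eexists => N; rewrite big_split/=; apply: lerD.
  apply: (@sum_samples_le R _ _ pi N (pi_gt0 R) (is_derive_cosT ip ixp)) => //.
  by move=> t; apply: cvgN; exact: (continuous_sinT ixp ixxp).
apply: (@sum_samples_le R _ _ pi N (pi_gt0 R) (is_derive_sinT ip ixp)) => //.
exact: (continuous_cosT ixp ixxp).
Qed.

End charfun_consequences.

(** * Poisson summation through the Fejer kernel *)

Section fejer.
Context {R : realType}.
Notation mu := (@lebesgue_measure R).
Implicit Types (t v y : R) (M N : nat).

Definition dirichlet M t : R := 1 + 2 * \sum_(k < M) cos (k.+1%:R * t).

Definition fejer N t : R := arithmetic_mean (dirichlet ^~ t) N.

Lemma fejerE N t : fejer N t = N.+1%:R^-1 * \sum_(k < N.+1) dirichlet k t.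
Proof. by rewrite /fejer /arithmetic_mean /series/= big_mkord. Qed.

Lemma dirichlet_telescope M t :
  (1 - cos t) * dirichlet M t = cos (M%:R * t) - cos (M.+1%:R * t).
Proof.
elim: M => [|M IH].
  by rewrite /dirichlet big_ord0 mulr0 addr0 mulr1 mul0r cos0 mul1r.
have -> : dirichlet M.+1 t = dirichlet M t + 2 * cos (M.+1%:R * t).
  by rewrite /dirichlet big_ord_recr/=; ring.
have e1 : M%:R * t = M.+1%:R * t - t by rewrite -[M.+1%:R]natr1; ring.
have e2 : M.+2%:R * t = M.+1%:R * t + t by rewrite -[M.+2%:R]natr1; ring.
rewrite mulrDr IH e1 e2 !cosD cosN sinN; ring.
Qed.

(** The closed form is kept multiplied by [1 - cos t] rather than divided by it, so that it also
    holds where [cos t = 1]. The sum of Dirichlet kernels telescopes. *)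
Lemma fejer_weight N t : (1 - cos t) * fejer N t = (1 - cos (N.+1%:R * t)) / N.+1%:R.
Proof.
rewrite fejerE mulrCA mulr_sumr mulrC; congr (_ / _).
rewrite (eq_bigr (fun k : 'I_N.+1 => cos (k%:R * t) - cos (k.+1%:R * t))); last first.
  by move=> k _; exact: dirichlet_telescope.
rewrite -(big_mkord xpredT (fun k => cos (k%:R * t) - cos (k.+1%:R * t))).
rewrite (@telescope_sumr_eq _ 0%N N.+1 (fun k => - cos (k%:R * t)))//.
  by rewrite mul0r cos0 opprK addrC.
by move=> k _; rewrite opprK addrC.
Qed.

Lemma cos_natmul_eq1 k t : cos t = 1 -> cos (k%:R * t) = 1.
Proof.
move=> ct; have st : sin t = 0.
  apply/eqP; rewrite -sqrf_eq0; have := cos2Dsin2 t.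
  by rewrite ct expr1n => H; apply/eqP; lra.
elim: k => [|k IH]; first by rewrite mul0r cos0.
by rewrite -natr1 mulrDl mul1r cosD IH ct st mulr0 subr0 mul1r.
Qed.

Lemma fejer_ge0 N t : 0 <= fejer N t.
Proof.
have [ct|ct] := eqVneq (cos t) 1.
  rewrite fejerE mulr_ge0 ?invr_ge0// sumr_ge0// => k _.
  rewrite /dirichlet addr_ge0// mulr_ge0// sumr_ge0// => j _.
  by rewrite cos_natmul_eq1.
have c0 : 0 < 1 - cos t by rewrite subr_gt0 lt_neqAle ct cos_le1.
by rewrite -(pmulr_rge0 _ c0) fejer_weight divr_ge0// subr_ge0 cos_le1.
Qed.

Lemma fejer_weight_le N t : (1 - cos t) * fejer N t <= 2 / N.+1%:R.
Proof.
by rewrite fejer_weight ler_wpM2r ?invr_ge0//; have := cos_geN1 (N.+1%:R * t); lra.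
Qed.

Lemma continuous_cosMl (c : R) : continuous (fun v : R => cos (c * v)).
Proof.
move=> v; apply: (@continuous_comp _ _ _ (fun v : R => c * v) cos).
  by apply: cvgM; [exact: cvg_cst|exact: cvg_id].
exact: continuous_cos.
Qed.

Lemma continuous_sum (I : Type) (s : seq I) (f : I -> R -> R) :
  (forall i, continuous (f i)) -> continuous (fun x => \sum_(i <- s) f i x).
Proof.
move=> cf; elim: s => [|i s IH] x.
  by under eq_fun do rewrite big_nil; exact: cvg_cst.
by under eq_fun do rewrite big_cons; apply: cvgD; [exact: cf|exact: IH].
Qed.

Lemma continuous_dirichlet M : continuous (fun v => dirichlet M (pi * v)).
Proof.
move=> v; apply: cvgD; first exact: cvg_cst.
apply: cvgM; first exact: cvg_cst.
apply: (@continuous_sum _ _ (fun (k : 'I_M) v => cos (k.+1%:R * (pi * v)))) => k {}v.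
under eq_fun do rewrite mulrA.
exact: continuous_cosMl.
Qed.

Lemma continuous_fejer N : continuous (fun v => fejer N (pi * v)).
Proof.
rewrite (_ : (fun _ => _) = (fun v => N.+1%:R^-1 * \sum_(k < N.+1) dirichlet k (pi * v))).
  move=> v; apply: cvgM; first exact: cvg_cst.
  apply: (@continuous_sum _ _ (fun (k : 'I_N.+1) v => dirichlet k (pi * v))) => k.
  exact: continuous_dirichlet.
by apply/funext => v; rewrite fejerE.
Qed.

Lemma integral_cos_period k : \int[mu]_(v in `[(-1)%R, 1%R]) cos (k.+1%:R * (pi * v)) = 0.
Proof.
have c0 : k.+1%:R * pi != 0 :> R by rewrite mulf_neq0// ?pnatr_eq0// gt_eqF// pi_gt0.
have d v : is_derive v 1 (fun v => sin (v * (k.+1%:R * pi)) * (k.+1%:R * pi)^-1)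
    (cos (k.+1%:R * (pi * v))).
  have -> : k.+1%:R * (pi * v) = v * (k.+1%:R * pi) by ring.
  have := is_derive_Mr (k.+1%:R * pi)^-1 (is_derive_sinMl (k.+1%:R * pi) v).
  by rewrite mulfK.
have sin0' : sin (k.+1%:R * pi) = 0 :> R.
  elim: k {c0 d} => [|k IH]; first by rewrite mul1r sinpi.
  by rewrite -natr1 mulrDl mul1r sinD IH sinpi mul0r mulr0 addr0.
have N11 : (-1 <= 1 :> R) by lra.
rewrite (integral_of_derivative N11 d); last first.
  by under eq_fun do rewrite mulrA; exact: continuous_cosMl.
by rewrite mulN1r sinN mul1r sin0' oppr0 mul0r subrr.
Qed.

Lemma Rintegral_sum (I : Type) (s : seq I) (f : I -> R -> R) (D : set (measurableTypeR R)) :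
  measurable D -> (forall i, mu.-integrable D (EFin \o f i)) ->
  \int[mu]_(x in D) (\sum_(i <- s) f i x) = \sum_(i <- s) \int[mu]_(x in D) f i x.
Proof.
move=> mD intf.
have intS r : mu.-integrable D (EFin \o (fun x => \sum_(i <- r) f i x)).
  elim: r => [|i r IH].
    rewrite (_ : _ \o _ = cst 0%E); first exact: integrable0.
    by apply/funext => x /=; rewrite big_nil.
  rewrite (_ : _ \o _ = (fun x => (f i x)%:E + (\sum_(j <- r) f j x)%:E)%E).
    by apply: integrableD => //; exact: intf.
  by apply/funext => x /=; rewrite big_cons EFinD.
elim: s => [|i s IH].
  rewrite big_nil; under eq_Rintegral do rewrite big_nil.
  by rewrite Rintegral_cst// mul0r.
by rewrite big_cons -IH -RintegralD//; under eq_Rintegral do rewrite big_cons.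
Qed.

Lemma integral_dirichlet M : \int[mu]_(v in `[(-1)%R, 1%R]) dirichlet M (pi * v) = 2.
Proof.
have ic (k : 'I_M) : mu.-integrable `[(-1)%R, 1%R] (EFin \o (fun v => cos (k.+1%:R * (pi * v)))).
  apply: continuous_integrable_itv; under eq_fun do rewrite mulrA; exact: continuous_cosMl.
have i1 : mu.-integrable `[(-1)%R, 1%R] (EFin \o cst (1 : R)).
  by apply: continuous_integrable_itv => x; exact: cvg_cst.
have is_ : mu.-integrable `[(-1)%R, 1%R] (EFin \o (fun v => \sum_(k < M) cos (k.+1%:R * (pi * v)))).
  apply: continuous_integrable_itv.
  apply: (@continuous_sum _ _ (fun (k : 'I_M) v => cos (k.+1%:R * (pi * v)))) => k v.
  under eq_fun do rewrite mulrA; exact: continuous_cosMl.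
rewrite /dirichlet RintegralD//; last first.
  rewrite (_ : _ \o _ = (fun v => 2%:E * (\sum_(k < M) cos (k.+1%:R * (pi * v)))%:E)%E)//.
  exact: integrableZl.
rewrite RintegralZl// (Rintegral_sum _ _ ic)//.
rewrite big1 ?mulr0 ?addr0; last by move=> k _; exact: integral_cos_period.
rewrite Rintegral_cst//= lebesgue_measure_itv/= lte_fin ifT; last by lra.
by rewrite -EFinD/= mul1r opprK; ring.
Qed.

Lemma integral_fejer N : \int[mu]_(v in `[(-1)%R, 1%R]) fejer N (pi * v) = 2.
Proof.
under eq_Rintegral do rewrite fejerE.
have id_ (k : 'I_N.+1) : mu.-integrable `[(-1)%R, 1%R] (EFin \o (fun v => dirichlet k (pi * v))).
  by apply: continuous_integrable_itv; exact: continuous_dirichlet.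
rewrite RintegralZl//; last first.
  apply: continuous_integrable_itv.
  apply: (@continuous_sum _ _ (fun (k : 'I_N.+1) v => dirichlet k (pi * v))) => k.
  exact: continuous_dirichlet.
rewrite (Rintegral_sum _ _ id_)//.
under eq_bigr do rewrite integral_dirichlet.
by rewrite sumr_const card_ord -[X in _ * X]mulr_natl mulKf// pnatr_eq0.
Qed.

(* The factor [1 - cos] absorbs the Fejer kernel, see [fejer_weight_le]. *)
Lemma fejer_modulus (q : R -> R) (B e : R) : continuous q -> (forall v, `|q v| <= B) ->
  0 < e -> exists2 K : R, 0 <= K &
    forall v, `|v| <= 1 -> `|q v - q 0| <= e + K * (1 - cos (pi * v)).
Proof.
move=> cq qB e0.
have near0 : \forall v \near (0 : R), `|q v - q 0| < e.
  by have /cvgrPdist_lt/(_ _ e0) := @cq 0; apply: filterS => v; rewrite distrC.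
have [dl /= dl0 ball0] := (nbhs_ballP _ _).1 near0.
have B0 : 0 <= B := le_trans (normr_ge0 _) (qB 0).
pose m := Num.min dl 1.
have m0 : 0 < m by rewrite lt_min dl0 ltr01.
have m1 : m <= 1 by rewrite ge_min lexx orbT.
have pi0 := pi_gt0 R.
have pim : pi * m <= pi by rewrite ler_piMr// ltW.
have k0 : 0 < 1 - cos (pi * m).
  rewrite subr_gt0 -(@cos0 R) ltr_cos ?in_itv/= ?lexx ?mulr_gt0// ?(ltW pi0)//.
  by rewrite mulr_ge0// ltW.
exists (2 * B / (1 - cos (pi * m))); first by rewrite divr_ge0 ?mulr_ge0 ?(ltW k0).
move=> v v1; have cv : cos (pi * v) = cos (pi * `|v|).
  by case: (ger0P v) => // _; rewrite mulrN cosN.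
have [vm|vm] := ltP `|v| m.
  rewrite (le_trans (ltW (ball0 v _)))//; last first.
    by rewrite lerDl mulr_ge0 ?subr_ge0 ?cos_le1// divr_ge0 ?mulr_ge0// ltW.
  by rewrite /ball/= sub0r normrN (lt_le_trans vm)// ge_min lexx.
have cle : cos (pi * `|v|) <= cos (pi * m).
  rewrite leNgt; apply/negP; rewrite ltr_cos ?in_itv/=; last 2 first.
  - by rewrite mulr_ge0 ?(ltW pi0)//= ler_piMr// ltW.
  - by rewrite mulr_ge0 ?(ltW pi0) ?(ltW m0).
  by apply/negP; rewrite ltr_pM2l// -leNgt.
rewrite cv (le_trans (ler_normB _ _))// (le_trans (lerD (qB v) (qB 0)))//.
have t1 : 1 <= (1 - cos (pi * `|v|)) / (1 - cos (pi * m)).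
  by rewrite ler_pdivlMr ?mul1r ?lerD2l ?lerN2.
rewrite ler_wpDl ?(ltW e0)// mulrAC -mulrA -[leLHS]mulr1 -mulr2n -[B *+ 2]mulr_natl.
by rewrite ler_wpM2l// mulr_ge0.
Qed.

(** The kernel has total mass 2 over a period. In the modulus bound for [q], the small constant is
    integrated against this mass, and the part with [1 - cos] meets a kernel weighted by [1 - cos],
    which is at most [2 / N.+1]. *)
Lemma fejer_cvg (q : R -> R) (B : R) : continuous q -> (forall v, `|q v| <= B) ->
  (fun N => \int[mu]_(v in `[(-1)%R, 1%R]) (q v * fejer N (pi * v))) @ \oo --> 2 * q 0.
Proof.
move=> cq qB; apply/cvgrPdist_le => e e0.
have e4 : 0 < e / 4 by rewrite divr_gt0.
have [K K0 HK] := fejer_modulus cq qB e4.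
(* Beyond this index the second part is at most [e / 4] pointwise, hence [e / 2] over an interval of
   length 2; the first part costs [2 * (e / 4)]. *)
have [N0 HN0] : exists N0 : nat, 8 * K / e <= N0%:R.
  exists (Num.bound (8 * K / e)); apply/ltW; apply: archi_boundP.
  by rewrite divr_ge0 ?mulr_ge0// ltW.
near=> N.
have cF := @continuous_fejer N.
have cqF : continuous (fun v => q v * fejer N (pi * v)).
  by move=> v; apply: cvgM; [exact: cq|exact: cF].
have ccF c : continuous (fun v => c * fejer N (pi * v)).
  by move=> v; apply: cvgM; [exact: cvg_cst|exact: cF].
have -> : 2 * q 0 = \int[mu]_(v in `[(-1)%R, 1%R]) (q 0 * fejer N (pi * v)).
  rewrite RintegralZl//; last exact: (@continuous_integrable_itv _ _ _ _ cF).
  by rewrite integral_fejer mulrC.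
rewrite -RintegralB//; [|exact: continuous_integrable_itv..].
have cd : continuous (fun v => q 0 * fejer N (pi * v) - q v * fejer N (pi * v)).
  by move=> v; apply: cvgB; [exact: ccF|exact: cqF].
apply: le_trans (le_normr_Rintegral _ _) _ => //; first exact: continuous_integrable_itv.
have cb : continuous (fun v => e / 4 * fejer N (pi * v) + K * (2 / N.+1%:R)).
  by move=> v; apply: cvgD; [exact: ccF|exact: cvg_cst].
apply: (@le_trans _ _ (\int[mu]_(v in `[(-1)%R, 1%R]) (e / 4 * fejer N (pi * v) + K * (2 / N.+1%:R)))).
  apply: le_Rintegral => //.
  - apply: continuous_integrable_itv => v.
    exact: (continuous_comp (@cd v) (@norm_continuous _ _ _)).
  - exact: continuous_integrable_itv.
  - move=> v /=; rewrite in_itv/= => v1.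
    have v1' : `|v| <= 1 by rewrite ler_norml.
    have F0 := fejer_ge0 N (pi * v).
    rewrite -mulrBl normrM (ger0_norm F0) distrC.
    apply: (le_trans (ler_wpM2r F0 (HK v v1'))).
    by rewrite mulrDl lerD2l -mulrA ler_wpM2l// fejer_weight_le.
rewrite RintegralD//; last 2 first.
- exact: continuous_integrable_itv.
- by apply: continuous_integrable_itv => x; exact: cvg_cst.
have iF : mu.-integrable `[(-1)%R, 1%R] (EFin \o (fun v => fejer N (pi * v))).
  exact: continuous_integrable_itv.
rewrite (RintegralZl (e / 4) _ iF)//.
rewrite integral_fejer Rintegral_cst//= lebesgue_measure_itv/= lte_fin ifT; last by lra.
rewrite -EFinD/= opprK.
have N1 : 8 * K / e <= N.+1%:R.
  rewrite (le_trans HN0)// ler_nat leqW//; near: N; exact: nbhs_infty_ge.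
have : 8 * K <= N.+1%:R * e by rewrite -ler_pdivrMr.
have : 0 < N.+1%:R :> R by [].
move: (N.+1%:R : R) => n n0 H.
have : K * (2 / n) <= e / 4.
  by rewrite mulrA ler_pdivrMr//; nra.
lra.
Unshelve. all: by end_near. Qed.

End fejer.

(** * Folding the line onto one period *)

Section poisson_summation.
Context {R : realType}.
Notation mu := (@lebesgue_measure R).
Variables (p : R -> R) (K0 : R).
Hypothesis p0 : forall x, 0 <= p x.
Hypothesis p_cont : continuous p.
Hypothesis ip : mu.-integrable setT (EFin \o p).
Hypothesis decay : forall x, p x <= K0 / (1 + x ^+ 2).

Lemma decay_ge0 : 0 <= K0.
Proof. by have := le_trans (p0 0) (decay 0); rewrite expr0n addr0 divr1. Qed.

Lemma decay_bound x : p x <= K0.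
Proof.
apply: (le_trans (decay x)); rewrite ler_pdivrMr ?ltr_pwDl ?sqr_ge0//.
by rewrite ler_peMr ?decay_ge0// lerDl sqr_ge0.
Qed.

Variable y : R.

(* the [k]-th Fourier term, real part of [e^{-i pi k y} f (pi k)] *)
Definition cos_term (k : nat) : R :=
  cos (pi * k%:R * y) * cosT p (pi * k%:R) + sin (pi * k%:R * y) * sinT p (pi * k%:R).

(** The symmetric partial sum over [|k| <= M] of the Fourier terms: those of index [k] and [-k] are
    conjugate and contribute twice their real part. *)
Definition cos_partial (M : nat) : R := cos_term 0 + 2 * \sum_(k < M) cos_term k.+1.

(** The truncated periodization of [p], as a function of the offset [v] within a cell of length 2;
    the value wanted is at [v = 0]. *)
Definition lattice_partial (M : nat) (v : R) : R :=
  p (y + v) + \sum_(m < M) (p (y + 2 * m.+1%:R + v) + p (y - 2 * m.+1%:R + v)).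

Let cos_term_int k : cos_term k = \int[mu]_u (cos (k%:R * (pi * (u - y))) * p u).
Proof.
rewrite /cos_term /cosT /sinT -!RintegralZl//; [|exact: integrable_sinT|exact: integrable_cosT].
rewrite -RintegralD//.
- apply: eq_Rintegral => u _.
  have -> : k%:R * (pi * (u - y)) = pi * k%:R * u - pi * k%:R * y by ring.
  by rewrite cosD cosN sinN; ring.
- apply: integrable_bounded_mul (integrable_cosT (pi * k%:R) ip) => // _; exact: cos_norm_le1.
- apply: integrable_bounded_mul (integrable_sinT (pi * k%:R) ip) => // _; exact: sin_norm_le1.
Qed.

Let int_cos k : mu.-integrable setT (EFin \o (fun u => cos (k%:R * (pi * (u - y))) * p u)).
Proof.
apply: integrable_bounded_mul => //; last by move=> x; exact: cos_norm_le1.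
apply: (measurableT_comp (continuous_measurable_fun (@continuous_cos R))).
by do 2 apply: measurable_funM => //; exact: measurable_funB.
Qed.

Let integrable_scale (c : R) (f : R -> R) : mu.-integrable setT (EFin \o f) ->
  mu.-integrable setT (EFin \o (fun u => c * f u)).
Proof.
move=> intf; rewrite (_ : _ \o _ = fun u => (c%:E * (f u)%:E)%E)//.
exact: integrableZl.
Qed.

Let integrable_bigsum (I : Type) (s : seq I) (f : I -> R -> R) :
  (forall i, mu.-integrable setT (EFin \o f i)) ->
  mu.-integrable setT (EFin \o (fun u => \sum_(i <- s) f i u)).
Proof.
move=> intf; elim: s => [|i s IH].
  rewrite (_ : _ \o _ = cst 0%E); first exact: integrable0.
  by apply/funext => x /=; rewrite big_nil.
rewrite (_ : _ \o _ = (fun x => (f i x)%:E + (\sum_(j <- s) f j x)%:E)%E).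
  by apply: integrableD => //; exact: intf.
by apply/funext => x /=; rewrite big_cons EFinD.
Qed.

Let dirichletE M u : dirichlet M (pi * (u - y)) * p u =
  cos (0%:R * (pi * (u - y))) * p u +
  2 * \sum_(k < M) (cos (k.+1%:R * (pi * (u - y))) * p u).
Proof. by rewrite mul0r cos0 /dirichlet mulrDl -mulrA mulr_suml. Qed.

Let int_dirichlet M : mu.-integrable setT (EFin \o (fun u => dirichlet M (pi * (u - y)) * p u)).
Proof.
rewrite (_ : _ \o _ = (fun u => (cos (0%:R * (pi * (u - y))) * p u)%:E +
  (2 * \sum_(k < M) (cos (k.+1%:R * (pi * (u - y))) * p u))%:E)%E); last first.
  by apply/funext => u /=; rewrite dirichletE EFinD.
apply: integrableD => //; first exact: int_cos.
apply: integrable_scale.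
by apply: (@integrable_bigsum _ _ (fun (k : 'I_M) u => cos (k.+1%:R * (pi * (u - y))) * p u)) => k.
Qed.

Let cos_partialE M : cos_partial M = \int[mu]_u (dirichlet M (pi * (u - y)) * p u).
Proof.
under eq_Rintegral do rewrite dirichletE.
rewrite RintegralD//; last first.
  apply: integrable_scale.
  by apply: (@integrable_bigsum _ _ (fun (k : 'I_M) u => cos (k.+1%:R * (pi * (u - y))) * p u)) => k.
rewrite RintegralZl//; last first.
  by apply: (@integrable_bigsum _ _ (fun (k : 'I_M) u => cos (k.+1%:R * (pi * (u - y))) * p u)) => k.
rewrite (@Rintegral_sum _ _ _ (fun (k : 'I_M) u => cos (k.+1%:R * (pi * (u - y))) * p u) setT)//.
rewrite /cos_partial cos_term_int; congr (_ + 2 * _).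
by apply: eq_bigr => k _; exact: cos_term_int.
Qed.

Let h N u : R := fejer N (pi * (u - y)) * p u.

Let hE N u : h N u = N.+1%:R^-1 * \sum_(k < N.+1) (dirichlet k (pi * (u - y)) * p u).
Proof. by rewrite /h fejerE -mulrA mulr_suml. Qed.

Let int_h N : mu.-integrable setT (EFin \o h N).
Proof.
rewrite (_ : h N = (fun u => N.+1%:R^-1 * \sum_(k < N.+1) (dirichlet k (pi * (u - y)) * p u))).
  apply: integrable_scale.
  by apply: (@integrable_bigsum _ _ (fun (k : 'I_N.+1) u => dirichlet k (pi * (u - y)) * p u)) => k.
by apply/funext => u; exact: hE.
Qed.

Let h0 N u : 0 <= h N u. Proof. by rewrite mulr_ge0// fejer_ge0. Qed.

Let fejer_meanE N : \int[mu]_u h N u = arithmetic_mean cos_partial N.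
Proof.
rewrite /arithmetic_mean /series/= big_mkord; under eq_Rintegral do rewrite hE.
rewrite RintegralZl//; last first.
  by apply: (@integrable_bigsum _ _ (fun (k : 'I_N.+1) u => dirichlet k (pi * (u - y)) * p u)) => k.
rewrite (@Rintegral_sum _ _ _ (fun (k : 'I_N.+1) u => dirichlet k (pi * (u - y)) * p u) setT)//.
by congr (_ * _); apply: eq_bigr => k _; rewrite cos_partialE.
Qed.

Let cos_shift (t : R) (m : nat) : cos (t + 2 * pi * m%:R) = cos t.
Proof.
elim: m => [|m IH]; first by rewrite mulr0 addr0.
have -> : t + 2 * pi * m.+1%:R = (t + 2 * pi * m%:R) + pi *+ 2.
  by rewrite -natr1 -mulr_natr; ring.
by rewrite cosD2pi.
Qed.

Let dirichlet_shift M (v : R) (m : nat) :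
  dirichlet M (pi * (2 * m%:R + v)) = dirichlet M (pi * v).
Proof.
rewrite /dirichlet; congr (_ + 2 * _); apply: eq_bigr => k _.
have -> : k.+1%:R * (pi * (2 * m%:R + v)) = k.+1%:R * (pi * v) + 2 * pi * (k.+1 * m)%:R.
  by rewrite natrM; ring.
exact: cos_shift.
Qed.

Let fejer_shift N (v : R) (m : nat) : fejer N (pi * (2 * m%:R + v)) = fejer N (pi * v).
Proof.
by rewrite !fejerE; congr (_ * _); apply: eq_bigr => k _; exact: dirichlet_shift.
Qed.

Let fejer_shiftN N (v : R) (m : nat) : fejer N (pi * (- (2 * m%:R) + v)) = fejer N (pi * v).
Proof. by rewrite -(fejer_shift N (- (2 * m%:R) + v) m) addrA subrr add0r. Qed.

Let unit_itv : set (measurableTypeR R) := [set` `[(-1)%R, 1%R]].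

Let int_translate N (c : R) :
  \int[mu]_(u in `[c - 1, c + 1]) h N u = \int[mu]_(v in unit_itv) h N (c + v).
Proof.
rewrite /Rintegral; congr fine.
have mh : measurable_fun setT (h N) by have /measurable_EFinP := measurable_int _ (int_h N).
have := @ge0_integral_affine R 1 c ltr01 unit_itv (h N) (measurable_itv _) mh (h0 N).
have -> : [set x | unit_itv ((x - c) / 1)] = `[c - 1, c + 1]%classic.
  by apply/seteqP; split=> x; rewrite /unit_itv /= !in_itv/= divr1; lra.
by move=> ->; apply: eq_integral => v _; rewrite !mul1r addrC.
Qed.

Let continuous_shift (c : R) : continuous (fun v => p (c + v)).
Proof.
move=> v; apply: (@continuous_comp _ _ _ (fun v : R => c + v) p); last exact: p_cont.
by apply: cvgD; [exact: cvg_cst|exact: cvg_id].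
Qed.

Let continuous_lattice M : continuous (lattice_partial M).
Proof.
move=> v; apply: cvgD; first exact: continuous_shift.
apply: (@continuous_sum _ _ _ (fun (m : 'I_M) v => p (y + 2 * m.+1%:R + v) + p (y - 2 * m.+1%:R + v))).
by move=> m u; apply: cvgD; exact: continuous_shift.
Qed.

Let lattice_partialS M v : lattice_partial M.+1 v =
  lattice_partial M v + (p (y + 2 * M.+1%:R + v) + p (y - 2 * M.+1%:R + v)).
Proof. by rewrite /lattice_partial big_ord_recr/= addrA. Qed.

Lemma lattice_partial_ge0 M v : 0 <= lattice_partial M v.
Proof. by rewrite addr_ge0// sumr_ge0// => m _; rewrite addr_ge0. Qed.

(** The window consists of [2 M + 1] cells of length 2 centred at the points [y + 2 m] with
    [|m| <= M]. Each is translated onto [[-1, 1]], which leaves the periodic kernel unchanged and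
    adds one translate of [p]. *)
Let integral_window M N :
  \int[mu]_(u in `[y - (2 * M%:R + 1), y + (2 * M%:R + 1)]) h N u =
  \int[mu]_(v in unit_itv) (lattice_partial M v * fejer N (pi * v)).
Proof.
have cF := @continuous_fejer R N.
have term (c : R) : (forall v, fejer N (pi * (c + v - y)) = fejer N (pi * v)) ->
    \int[mu]_(u in `[c - 1, c + 1]) h N u =
    \int[mu]_(v in unit_itv) (p (c + v) * fejer N (pi * v)).
  by move=> H; rewrite int_translate; apply: eq_Rintegral => v _; rewrite /h H mulrC.
have ci (f : R -> R) : continuous f ->
    mu.-integrable unit_itv (EFin \o (fun v => f v * fejer N (pi * v))).
  by move=> cf; apply: continuous_integrable_itv => v; apply: cvgM; [exact: cf|exact: cF].
elim: M => [|M IH].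
  rewrite mulr0 add0r term//; last by move=> v; rewrite addrAC subrr add0r.
  by apply: eq_Rintegral => v _; rewrite /lattice_partial big_ord0 addr0.
have MS : 2 * M.+1%:R = 2 * M%:R + 2 :> R by rewrite -natr1; ring.
have M0 : 0 <= M%:R :> R by [].
rewrite (@Rintegral_itv_cat R (h N) _ (y - (2 * M%:R + 1)) _ _ _ (int_h N));
  try by rewrite MS; lra.
rewrite (@Rintegral_itv_cat R (h N) (y - (2 * M%:R + 1)) (y + (2 * M%:R + 1)) _ _ _ (int_h N));
  try by rewrite ?MS; lra.
rewrite IH.
have -> : y - (2 * M.+1%:R + 1) = y - 2 * M.+1%:R - 1 by ring.
have -> : y - (2 * M%:R + 1) = y - 2 * M.+1%:R + 1 by rewrite MS; ring.
have -> : y + (2 * M.+1%:R + 1) = y + 2 * M.+1%:R + 1 by ring.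
have -> : y + (2 * M%:R + 1) = y + 2 * M.+1%:R - 1 by rewrite MS; ring.
rewrite !term//; last 2 first.
- move=> v; have -> : y + 2 * M.+1%:R + v - y = 2 * M.+1%:R + v by ring.
  exact: fejer_shift.
- move=> v; have -> : y - 2 * M.+1%:R + v - y = - (2 * M.+1%:R) + v by ring.
  exact: fejer_shiftN.
rewrite addrCA -RintegralD//; [|exact: measurable_itv|exact: ci..].
rewrite addrC -RintegralD//; last 3 first.
- exact: measurable_itv.
- rewrite (_ : _ \o _ = (fun v => (p (y - 2 * M.+1%:R + v) * fejer N (pi * v))%:E +
    (p (y + 2 * M.+1%:R + v) * fejer N (pi * v))%:E)%E)//.
  by apply: integrableD; [exact: measurable_itv|exact: ci..].
- exact: ci.
by apply: eq_Rintegral => v _; rewrite lattice_partialS; ring.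
Qed.

(** Both arguments have absolute value at least [M.+1], where [p] is at most [K0 / (M * M.+1)]; this
    form is chosen because it telescopes. *)
Let tail_step M v : `|y| + 1 <= M%:R -> `|v| <= 1 -> (0 < M)%N ->
  p (y + 2 * M.+1%:R + v) + p (y - 2 * M.+1%:R + v) <= 2 * K0 * (M%:R^-1 - M.+1%:R^-1).
Proof.
move=> yM v1 M0; have KK := decay_ge0.
have m0 : 0 < M%:R :> R by rewrite ltr0n.
have bd x : M.+1%:R <= `|x| -> p x <= K0 * (M%:R^-1 - M.+1%:R^-1).
  move=> Mx; apply: (le_trans (decay x)); rewrite ler_wpM2l//.
  have -> : M%:R^-1 - M.+1%:R^-1 = (M%:R * M.+1%:R)^-1 :> R.
    rewrite -[M.+1%:R]natr1; move: (M%:R : R) m0 => a a0.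
    have a1 : a + 1 != 0 by rewrite gt_eqF//; lra.
    by field; rewrite a1 gt_eqF.
  rewrite lef_pV2 ?posrE ?mulr_gt0 ?ltr_pwDl ?sqr_ge0//.
  rewrite -real_normK ?num_real// ler_wpDl// expr2 ler_pM//.
  by rewrite (le_trans _ Mx)// ler_nat.
move: yM v1; rewrite -lerBrDr !ler_norml => /andP[y1 y2] /andP[v1 v2].
have -> : 2 * K0 * (M%:R^-1 - M.+1%:R^-1) = K0 * (M%:R^-1 - M.+1%:R^-1) + K0 * (M%:R^-1 - M.+1%:R^-1).
  by ring.
rewrite lerD// bd//.
  by rewrite (le_trans _ (ler_norm _))// -[M.+1%:R]natr1; lra.
by rewrite -normrN (le_trans _ (ler_norm _))// -[M.+1%:R]natr1; lra.
Qed.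

Let tail_bound M j v : `|y| + 1 <= M%:R -> `|v| <= 1 -> (0 < M)%N ->
  lattice_partial (M + j) v <= lattice_partial M v + 2 * K0 * (M%:R^-1 - (M + j)%:R^-1).
Proof.
move=> yM v1 M0; elim: j => [|j IH]; first by rewrite addn0 subrr mulr0 addr0.
rewrite addnS lattice_partialS.
have := @tail_step (M + j) v _ v1 _.
rewrite addn_gt0 M0 (le_trans yM) ?ler_nat ?leq_addr// => /(_ isT isT) st.
apply: (le_trans (lerD IH st)); rewrite -addrA -mulrDr lerD2l.
by rewrite addrA subrK.
Qed.

Let window_le M N : \int[mu]_(v in unit_itv) (lattice_partial M v * fejer N (pi * v))
  <= arithmetic_mean cos_partial N.
Proof.
by rewrite -integral_window -fejer_meanE; apply: le_Rintegral_setT.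
Qed.

Let int_lattice M N :
  mu.-integrable unit_itv (EFin \o (fun v => lattice_partial M v * fejer N (pi * v))).
Proof.
apply: continuous_integrable_itv => v; apply: cvgM; first exact: continuous_lattice.
exact: continuous_fejer.
Qed.

(** The whole line is exhausted by the windows of size [M + j]. Their extra cells add at most
    [2 * K0 / M] to the periodization, uniformly on the period, and the kernel has mass 2. *)
Let window_ge M N : `|y| + 1 <= M%:R -> (0 < M)%N -> arithmetic_mean cos_partial N <=
  \int[mu]_(v in unit_itv) (lattice_partial M v * fejer N (pi * v)) + 4 * K0 / M%:R.
Proof.
move=> yM M0; have KK := decay_ge0.
pose win (j : nat) := [set` `[y - (2 * (M + j)%:R + 1), y + (2 * (M + j)%:R + 1)]] : set (measurableTypeR R).
have mw j : measurable (win j) by exact: measurable_itv.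
have win_mono : {homo win : n m / (n <= m)%N >-> (n <= m)%O}.
  move=> j1 j2 j12; rewrite subsetEset => x; rewrite /win/= !in_itv/=.
  have : (M + j1)%:R <= (M + j2)%:R :> R by rewrite ler_nat leq_add2l.
  lra.
have winT : \bigcup_j win j = setT.
  rewrite -subTset => x _; exists (Num.bound `|x - y|) => //.
  have : `|x - y| < (Num.bound `|x - y|)%:R by exact: archi_boundP.
  rewrite /win/= in_itv/= natrD ltr_norml.
  have : 0 <= M%:R :> R by [].
  lra.
have mh : measurable_fun setT (EFin \o h N) by exact: measurable_int (int_h N).
have := @ge0_nondecreasing_set_cvg_integral _ _ R win (EFin \o h N) mu win_mono mw
  (fun j => measurable_funTS mh) (fun j x _ => h0 N x).
rewrite winT => cvw.
rewrite -lee_fin -fejer_meanE -EFin_Rintegral//.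
rewrite -(cvg_lim (@ereal_hausdorff R) cvw).
apply: lime_le; first by apply: cvgP cvw.
apply: nearW => j.
rewrite [leLHS](_ : _ =
    (\int[mu]_(v in unit_itv) (lattice_partial (M + j) v * fejer N (pi * v)))%:E); last first.
  by rewrite -integral_window -EFin_Rintegral//; apply: integrableS (int_h N).
rewrite lee_fin.
have cF := @continuous_fejer R N.
have iF : mu.-integrable unit_itv (EFin \o (fun v => fejer N (pi * v))).
  exact: continuous_integrable_itv.
have iF2 : mu.-integrable unit_itv (EFin \o (fun v => 2 * K0 / M%:R * fejer N (pi * v))).
  by apply: continuous_integrable_itv => v; apply: cvgM; [exact: cvg_cst|exact: cF].
have -> : 4 * K0 / M%:R = \int[mu]_(v in unit_itv) (2 * K0 / M%:R * fejer N (pi * v)).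
  rewrite (RintegralZl _ _ iF) ?integral_fejer; last exact: measurable_itv.
  by ring.
rewrite -RintegralD//; last exact: measurable_itv.
apply: le_Rintegral => //; first exact: measurable_itv.
  rewrite (_ : _ \o _ = (fun v => (lattice_partial M v * fejer N (pi * v))%:E +
    (2 * K0 / M%:R * fejer N (pi * v))%:E)%E)//.
  by apply: integrableD; [exact: measurable_itv|exact: int_lattice|exact: iF2].
move=> v; rewrite /unit_itv/= in_itv/= => v1.
rewrite -mulrDl ler_wpM2r ?fejer_ge0//.
apply: le_trans (tail_bound j yM _ M0) _; first by rewrite ler_norml.
rewrite lerD2l ler_wpM2l ?mulr_ge0// lerBlDr lerDl invr_ge0//.
Qed.

(** The Cesaro means also tend to [H]. With [M] fixed, letting [N] grow in [window_le] and
    [window_ge] encloses [H] between [2 * lattice_partial p y M 0] and the same quantity plus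
    [4 * K0 / M]; only then does [M] grow. *)
Theorem poisson_summation (H : R) : cos_partial @ \oo --> H ->
  (fun M => 2 * lattice_partial M 0) @ \oo --> H.
Proof.
move=> cH; have aH := cesaro cH; have KK := decay_ge0.
have IL M : (fun N => \int[mu]_(v in `[(-1)%R, 1%R]) (lattice_partial M v * fejer N (pi * v)))
    @ \oo --> 2 * lattice_partial M 0.
  apply: (@fejer_cvg R _ (M.*2.+1%:R * K0)); first exact: continuous_lattice.
  move=> v; rewrite ger0_norm ?lattice_partial_ge0// /lattice_partial.
  rewrite -[M.*2.+1%:R]nat1r mulrDl mul1r lerD ?decay_bound//.
  apply: (@le_trans _ _ (\sum_(m < M) (K0 + K0))).
    by apply: ler_sum => m _; rewrite lerD ?decay_bound.
  by rewrite sumr_const card_ord -mulr2n -mulrnA mul2n mulr_natl.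
apply/cvgrPdist_le => e e0.
near=> M.
have yM : `|y| + 1 <= M%:R by near: M; exact: nbhs_infty_ger.
have M0 : (0 < M)%N by near: M; exact: nbhs_infty_gt.
have Me : 4 * K0 / e <= M%:R by near: M; exact: nbhs_infty_ger.
have m0 : 0 < M%:R :> R by rewrite ltr0n.
have lo : 2 * lattice_partial M 0 <= H.
  apply: (ler_cvg_to (IL M) aH); apply: nearW => N; exact: window_le.
have up : H <= 2 * lattice_partial M 0 + 4 * K0 / M%:R.
  apply: (ler_cvg_to aH (cvgD (IL M) (cvg_cst (4 * K0 / M%:R)))).
  by apply: nearW => N; exact: window_ge.
have : 4 * K0 / M%:R <= e by rewrite ler_pdivrMr// [leRHS]mulrC -ler_pdivrMr.
by rewrite ger0_norm ?subr_ge0//; lra.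
Unshelve. all: by end_near. Qed.

End poisson_summation.

(** * The density of the normalized sum *)

Section density_of_sums.
Context {R : realType}.
Notation mu := (@lebesgue_measure R).

Definition sum_density (p : R -> R) (n : nat) (x : R) : R :=
  \sum_(k < n.+1) bin_half n k * p (x - n%:R + 2 * k%:R).

(** Pascal's rule. In terms of densities, this is conditioning on the last of the signs. *)
Lemma sum_densityS p n x :
  sum_density p n.+1 x = 2^-1 * sum_density p n (x - 1) + 2^-1 * sum_density p n (x + 1).
Proof.
rewrite /sum_density /bin_half big_ord_recl/= bin0 !mulr_sumr.
rewrite (eq_bigr (fun k : 'I_n.+1 => 2^-1 * ('C(n, k.+1)%:R / 2 ^+ n * p (x - 1 - n%:R + 2 * k.+1%:R))
   + 2^-1 * ('C(n, k)%:R / 2 ^+ n * p (x + 1 - n%:R + 2 * k%:R)))); last first.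
  move=> k _; rewrite /bump/= add1n binS natrD exprS.
  have -> : x - n.+1%:R + 2 * k.+1%:R = x - 1 - n%:R + 2 * k.+1%:R.
    by rewrite -[n.+1%:R]natr1; ring.
  have -> : x + 1 - n%:R + 2 * k%:R = x - 1 - n%:R + 2 * k.+1%:R.
    by rewrite -[k.+1%:R]natr1; ring.
  by field; rewrite expf_neq0.
rewrite big_split/= addrA; congr (_ + _).
rewrite [in RHS]big_ord_recl/= bin0 exprS; congr (_ + _).
  have -> : x - n.+1%:R + 2 * 0 = x - 1 - n%:R + 2 * 0.
    by rewrite -[n.+1%:R]natr1; ring.
  by field; rewrite expf_neq0.
rewrite big_ord_recr/= bin_small// !mul0r mulr0 addr0.
by apply: eq_bigr => k _; rewrite /bump/= add1n.
Qed.

Lemma sum_density_ge0 p n x : (forall x, 0 <= p x) -> 0 <= sum_density p n x.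
Proof.
by move=> p0; apply: sumr_ge0 => k _; rewrite mulr_ge0// /bin_half divr_ge0// exprn_ge0.
Qed.

Lemma measurable_sum_density p n : measurable_fun setT p ->
  measurable_fun setT (sum_density p n).
Proof.
move=> mp; apply: measurable_sum => k; apply: measurable_funM => //.
apply: (measurableT_comp mp).
by apply: measurable_funD => //; exact: measurable_funB.
Qed.

Context d (T : measurableType d) (P : probability T R).
Variables (X : {RV P >-> R}) (xi : nat -> {RV P >-> R}) (p : R -> R).
Hypothesis dX : is_density P X p.
Hypothesis xi_pm1 : forall i, symmetric_bernoulli P (xi i).
Hypothesis indep : mutually_independent P (cons_rv X xi).

Let Y : nat -> T -> R := cons_rv X xi.
Let W n w := X w + \sum_(i < n) xi i w.
Let mp : measurable_fun setT p. Proof. by case: dX. Qed.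
Let p0 x : 0 <= p x. Proof. by case: dX. Qed.
Let q n := sum_density p n.
Let q0 n x : 0 <= q n x. Proof. exact: sum_density_ge0. Qed.
Let mq n : measurable_fun setT (q n). Proof. exact: measurable_sum_density. Qed.

Let mW n : measurable_fun setT (W n).
Proof. by apply: measurable_funD => //; apply: measurable_sum. Qed.

Let mYB j (B : set R) : measurable B -> measurable (Y j @^-1` B).
Proof. by case: j => [|j] mB; exact: measurable_funPTI. Qed.

Let cyl (J : {fset nat}) (Bs : nat -> set R) := \bigcap_(j in [set` J]) Y j @^-1` Bs j.

Let mcyl J Bs : (forall j, measurable (Bs j)) -> measurable (cyl J Bs).
Proof.
move=> mBs; apply: fin_bigcap_measurable; first exact: finite_fset.
by move=> j _; exact: mYB.
Qed.

Let cylU1 J Bs j0 B0 : j0 \notin J ->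
  cyl (j0 |` J)%fset (fun j => if j == j0 then B0 else Bs j) = Y j0 @^-1` B0 `&` cyl J Bs.
Proof.
move=> j0J; rewrite /cyl set_fsetU1 bigcap_setU bigcap_set1 eqxx; congr (_ `&` _).
apply: eq_bigcapr => j /= jJ; case: eqP => // ej.
by rewrite -ej jJ in j0J.
Qed.

Let prodU1 (J : {fset nat}) Bs j0 B0 : j0 \notin J ->
  (\prod_(j <- (j0 |` J)%fset) P (Y j @^-1` (if j == j0 then B0 else Bs j)) =
  P (Y j0 @^-1` B0) * \prod_(j <- J) P (Y j @^-1` Bs j))%E.
Proof.
move=> j0J; rewrite big_fsetU1//= eqxx; congr (_ * _)%E.
by apply: eq_fbigr => j jJ _; case: eqP => // ej; rewrite -ej jJ in j0J.
Qed.

(* The events on later variables are carried along because independence is an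
   assumption on events and the next step of the induction needs it for the sum. *)
Lemma sum_density_cylinder n (J : {fset nat}) (Bs : nat -> set R) (B : set R) :
  measurable B -> (forall j, measurable (Bs j)) -> (forall j, j \in J -> (n < j)%N) ->
  P (W n @^-1` B `&` cyl J Bs) =
  ((\int[mu]_(x in B) (q n x)%:E) * \prod_(j <- J) P (Y j @^-1` Bs j))%E.
Proof.
elim: n J Bs B => [|n IH] J Bs B mB mBs nJ.
  have J0 : 0%N \notin J by apply/negP => /nJ.
  have -> : W 0 @^-1` B = Y 0%N @^-1` B.
    by apply/seteqP; split=> w; rewrite /W /= big_ord0 addr0.
  have mBs' j : measurable (if j == 0%N then B else Bs j) by case: ifP.
  rewrite -cylU1// indep// prodU1//; congr (_ * _)%E.
  rewrite /Y/=; case: dX => _ _ ->//; apply: eq_integral => x _.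
  by rewrite /q /sum_density big_ord1 /bin_half bin0 expr0 divr1 mul1r subr0 mulr0 addr0.
have nJ1 : n.+1 \notin J by apply/negP => /nJ; rewrite ltnn.
have mE : measurable (W n.+1 @^-1` B `&` cyl J Bs).
  apply: measurableI; last exact: mcyl.
  by rewrite -[_ @^-1` _]setTI; exact: mW.
set E := W n.+1 @^-1` B `&` cyl J Bs in mE *.
pose S (s : R) := xi n @^-1` [set s].
have mS s : measurable (S s) by exact: measurable_funPTI.
(* On the event that the last sign is [s], the sum [W n.+1] lies in [B] exactly when [W n] lies in
   [B] shifted by [- s]. The event itself becomes one more coordinate condition, of index [n.+1]
   since [xi n] comes after [X] and [n] other signs, so the induction hypothesis applies. *)
have half s (Bs_ : set R) : P (S s) = (2^-1)%:E ->
    measurable Bs_ -> Bs_ = [set y | B ((y - (- s)) / 1)] ->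
    P (E `&` S s) = (2^-1%:E * (\int[mu]_(x in B) (q n (x - s))%:E) *
      \prod_(j <- J) P (Y j @^-1` Bs j))%E.
  move=> PS mBs_ BsE.
  have -> : E `&` S s = W n @^-1` Bs_ `&`
      cyl (n.+1 |` J)%fset (fun j => if j == n.+1 then [set s] else Bs j).
    rewrite cylU1// BsE /E /S; apply/seteqP; split=> w /=.
      move=> [[WB c] xs]; rewrite /W big_ord_recr/= xs addrA in WB.
      by rewrite opprK divr1.
    move=> [WB [xs c]]; rewrite /Y/= in xs; split=> //; split=> //.
    by rewrite /W big_ord_recr/= xs addrA; move: WB; rewrite opprK divr1.
  have mBs' j : measurable (if j == n.+1 then [set s] else Bs j) by case: ifP.
  rewrite IH//; last first.
    by move=> j; rewrite !inE => /predU1P[->//|/nJ /ltnW].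
  rewrite prodU1// -/(S s) PS BsE.
  rewrite (@ge0_integral_affine R 1 (- s) ltr01 B (q n))//.
  rewrite muleCA muleA; congr (_ * _ * _)%E.
  by apply: eq_integral => x _; rewrite !mul1r.
have mshift s : measurable [set y | B ((y - (- s)) / 1)].
  rewrite -[X in measurable X]setTI.
  have : measurable_fun setT (fun y : R => (y - (- s)) / 1).
    by apply: measurable_funM => //; exact: measurable_funB.
  by apply.
have [P1 P2] := xi_pm1 n.
have Sdisj : S 1 `&` S (-1) = set0.
  by rewrite -subset0 => w []; rewrite /S/= => ->; lra.
have mU : measurable (S 1 `|` S (-1)) by exact: measurableU.
have -> : P E = (P (E `&` S 1%R) + P (E `&` S (-1)%R))%E.
  rewrite -measureU; [|exact: measurableI|exact: measurableI|]; last first.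
    by rewrite setIACA setIid Sdisj setI0.
  rewrite -setIUr.
  (* The two values exhaust the probability, so the sign takes any other value with probability
     zero. *)
  have PC : P (~` (S 1%R `|` S (-1)%R)) = 0%E.
    have PS1 : P (S 1) = (2^-1)%:E := P1.
    have PS2 : P (S (-1)) = (2^-1)%:E := P2.
    rewrite probability_setC// measureU//.
    change ((1 - (P (S 1%R) + P (S (-1)%R)))%E = 0%E).
    rewrite PS1 PS2 -EFinD.
    have -> : 2^-1 + 2^-1 = 1 :> R by field.
    by rewrite subrr.
  rewrite -[in LHS](setIT E) -(setUv (S 1 `|` S (-1))) setIUr measureU0//.
  - exact: measurableI.
  - by apply: measurableI => //; exact: measurableC.
  - apply/eqP; rewrite -measure_le0 -PC; apply: le_measure; rewrite ?inE.
    + by apply: measurableI => //; exact: measurableC.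
    + exact: measurableC.
    + exact: subIsetr.
rewrite (half 1 _ P1 (mshift 1) erefl) (half (-1) _ P2 (mshift (-1)) erefl).
have mqs s : measurable_fun B (fun x => (q n (x - s))%:E).
  apply/measurable_funTS/measurable_EFinP/(measurableT_comp (mq n)).
  exact: measurable_funB.
have I0 s : (0 <= 2^-1%:E * \int[mu]_(x in B) (q n (x - s))%:E)%E.
  by rewrite mule_ge0 ?lee_fin ?invr_ge0//; apply: integral_ge0 => x _; rewrite lee_fin.
rewrite -ge0_muleDl//; congr (_ * _)%E.
rewrite -!ge0_integralZl//; try by move=> x _; rewrite lee_fin.
rewrite -ge0_integralD//; last 4 first.
- by move=> x _; rewrite mule_ge0// lee_fin// invr_ge0.
- by apply: measurable_funeM; exact: mqs.
- by move=> x _; rewrite mule_ge0// lee_fin// invr_ge0.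
- by apply: measurable_funeM; exact: mqs.
- by apply: eq_integral => x _; rewrite -!EFinM -EFinD /q sum_densityS opprK.
- exact: mqs.
- exact: mqs.
Qed.

Lemma Zsum_density n : (0 < n)%N -> is_density P (Zsum X xi n)
  (fun x => Num.sqrt n%:R * sum_density p n (Num.sqrt n%:R * x)).
Proof.
move=> n0; have rt0 : 0 < Num.sqrt n%:R :> R by rewrite sqrtr_gt0 ltr0n.
set rt := Num.sqrt n%:R in rt0 *.
split.
- apply: measurable_funM => //; apply: (measurableT_comp (mq n)).
  exact: measurable_funM.
- by move=> x; rewrite mulr_ge0 ?(ltW rt0)//; exact: q0.
move=> B mB.
(* With no condition on later variables the cylinder is the whole space and the product is 1. *)
have := @sum_density_cylinder n fset0 (fun=> setT) [set y | B ((y - 0) / rt)] _ _ _.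
rewrite /cyl set_fset0 bigcap_set0 setIT big_nil mule1 => H.
have -> : Zsum X xi n @^-1` B = W n @^-1` [set y | B ((y - 0) / rt)].
  by apply/seteqP; split=> w; rewrite /Zsum /= subr0.
rewrite {}H//; last first.
  rewrite -[X in measurable X]setTI.
  have : measurable_fun setT (fun y : R => (y - 0) / rt).
    by apply: measurable_funM => //; exact: measurable_funB.
  by apply.
rewrite (@ge0_integral_affine R rt 0 rt0 B (q n))//.
by apply: eq_integral => x _; rewrite addr0.
Qed.

End density_of_sums.

#[local] Existing Instance summability.totally_filter.

(** * Unconditional sums over the integers *)

Section unconditional_sums.
Context {R : realType}.

Lemma sum_uniq_nat_le (tau : nat -> R) (s : seq nat) K : (forall k, 0 <= tau k) ->
  uniq s -> (forall k, k \in s -> (k < K)%N) ->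
  \sum_(k <- s) tau k <= \sum_(k < K) tau k.
Proof.
move=> tau0 us sK; rewrite -(big_mkord xpredT tau) /index_iota subn0.
rewrite [X in _ <= X](bigID (mem s))/= -[leLHS]addr0; apply: lerD; last exact: sumr_ge0.
rewrite -[X in _ <= X]big_filter le_eqVlt; apply/orP; left; apply/eqP/perm_big.
apply: uniq_perm => //; first by rewrite filter_uniq// iota_uniq.
by move=> k; rewrite mem_filter mem_iota add0n /=; case: (boolP (k \in s)) => //= /sK ->.
Qed.

(** Each distance to [m0] is attained at most twice, once on either side; [K] only has to exceed the
    distances that occur in [J]. *)
Lemma sum_fset_int_le (tau : nat -> R) (J : {fset int}) (m0 : int) :
  (forall k, 0 <= tau k) ->
  exists K, \sum_(m <- J) tau `|m - m0|%N <= 2 * \sum_(k < K) tau k.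
Proof.
move=> tau0; pose g (m : int) := `|m - m0|%N.
pose K := (\max_(m <- J) g m).+1; exists K.
rewrite (bigID (fun m => m0 <= m))/= mulr2n mulrDl !mul1r.
have half (Q : pred int) : {in [pred m | Q m] &, injective g} ->
    \sum_(m <- J | Q m) tau (g m) <= \sum_(k < K) tau k.
  move=> gI; rewrite -big_filter -(big_map g xpredT); apply: sum_uniq_nat_le => //.
    rewrite map_inj_in_uniq ?filter_uniq ?fset_uniq// => a b.
    by rewrite !mem_filter => /andP[? _] /andP[? _]; exact: gI.
  move=> k /mapP[m]; rewrite mem_filter => /andP[_ mJ] ->.
  by rewrite ltnS; exact: leq_bigmax_seq.
by apply: lerD; apply: half => a b; rewrite !inE /g; lia.
Qed.

Lemma series_tail_lt (tau : nat -> R) M e : (forall k, 0 <= tau k) ->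
  (forall N, \sum_(k < N) tau k <= M) -> 0 < e ->
  exists N, forall K, \sum_(k < K) (if (N <= k)%N then tau k else 0) < e.
Proof.
move=> tau0 tauM e0; pose E := range (fun N => \sum_(k < N) tau k).
have hE : has_sup E.
  by split; [exists (\sum_(k < 0) tau k), 0%N|exists M => _ [N _ <-]; exact: tauM].
have [_ [N _ <-] NE] := sup_adherent e0 hE; exists N => K.
have KE : \sum_(k < N) tau k + \sum_(k < K) (if (N <= k)%N then tau k else 0) <= sup E.
  apply: (@le_trans _ _ (\sum_(k < maxn N K) tau k)); last by apply: sup_upper_bound => //; exists (maxn N K).
  rewrite (bigID (fun k : 'I_(maxn N K) => (k < N)%N))/=; apply: lerD.
    by rewrite (big_ord_widen (maxn N K) tau) ?leq_maxl.
  rewrite (big_ord_widen (maxn N K) (fun k => if (N <= k)%N then tau k else 0)) ?leq_maxr//.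
  rewrite big_mkcond [leRHS]big_mkcond/=; apply: ler_sum => k _.
  by rewrite -leqNgt; do 2 case: ifP.
by rewrite ltrBlDr in NE; rewrite -(ltrD2l (\sum_(k < N) tau k)) (le_lt_trans KE)// addrC.
Qed.

(** Locked so that simplification does not unfold the list; membership is given by
    [in_int_window]. *)
Definition int_window (M : nat) : {fset int} :=
  locked [fset m | m in [seq (k%:Z - M%:Z) | k <- iota 0 (2 * M).+1]]%fset.

Lemma in_int_window M m : (m \in int_window M) = (`|m| <= M)%N.
Proof.
rewrite /int_window -lock; move: (iota _ _) (mem_iota 0 (2 * M).+1) => s sE.
rewrite !inE /=; apply/idP/idP.
  by move=> /mapP[k]; rewrite sE => ? ->; lia.
move=> mM; apply/mapP; exists (absz (m + M%:Z)).
  by rewrite sE; lia.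
by lia.
Qed.

Lemma sum_int_window (V : zmodType) (u : int -> V) M :
  \sum_(m <- int_window M) u m = u 0 + \sum_(k < M) (u k.+1%:Z + u (- k.+1%:Z)).
Proof.
elim: M => [|M IH].
  rewrite big_ord0 addr0.
  have -> : int_window 0 = [fset (0 : int)]%fset.
    by apply/fsetP => m; rewrite in_int_window !inE; lia.
  by rewrite big_seq_fset1.
have -> : int_window M.+1 = (M.+1%:Z |` (- M.+1%:Z |` int_window M))%fset.
  by apply/fsetP => m; rewrite !in_fset1U !in_int_window; lia.
rewrite !big_fsetU1/=; last 2 first.
- by rewrite in_int_window; lia.
- by rewrite in_fset1U in_int_window; lia.
by rewrite IH big_ord_recr/= addrA addrC -!addrA.
Qed.


(** A finite set containing a large symmetric window splits into that window, whose sum is close to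
    [L], and a remainder away from 0, whose sum is small. The scalars are left general to serve both
    real and complex terms. *)
Lemma partial_sum_cvg (K : numFieldType) (V : normedModType K) (u : int -> V) (L : V) :
  (forall e : K, 0 < e -> exists N, forall J : {fset int},
    (forall m, m \in J -> (N <= `|m|)%N) -> `|\sum_(m <- J) u m| < e) ->
  (fun M => u 0 + \sum_(k < M) (u k.+1%:Z + u (- k.+1%:Z))) @ \oo --> L ->
  summability.partial_sum u @ summability.totally --> L.
Proof.
move=> tail /cvgrPdist_lt cL; apply/cvgrPdist_lt => e e0.
have e20 : 0 < e / 2 by rewrite divr_gt0.
have [N HN] := tail _ e20.
have [M _ HM] := cL _ e20.
pose M' := maxn M N; exists (int_window M') => // B WB.
rewrite /summability.partial_sum -(big_seq_fsetE _ _ xpredT u)/=.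
rewrite (big_fsetID _ (mem (int_window M')))/=.
have -> : [fset x in B | x \in int_window M']%fset = int_window M'.
  apply/fsetP => m; rewrite !inE/=; apply/andP/idP => [[]//|mW].
  by split=> //; exact: (fsubsetP WB).
rewrite sum_int_window opprD addrA (le_lt_trans (ler_normB _ _))//.
rewrite [e]splitr ltrD//; first by apply: HM; rewrite /= leq_maxl.
apply: HN => m; rewrite !inE/= => /andP[_].
by rewrite in_int_window -ltnNge => /ltnW; apply: leq_trans; rewrite leq_maxr.
Qed.
Lemma fset_tail_lt (tau : nat -> R) M e : (forall k, 0 <= tau k) ->
  (forall N, \sum_(k < N) tau k <= M) -> 0 < e ->
  exists N, forall J : {fset int}, (forall m, m \in J -> (N <= `|m|)%N) ->
    \sum_(m <- J) tau `|m|%N < e.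
Proof.
move=> tau0 tauM e0; have e20 : 0 < e / 2 by rewrite divr_gt0.
have [N HN] := series_tail_lt tau0 tauM e20; exists N => J NJ.
have [|K HK] := @sum_fset_int_le (fun k => if (N <= k)%N then tau k else 0) J 0.
  by move=> k; case: ifP.
have -> : \sum_(m <- J) tau `|m|%N =
    \sum_(m <- J) (if (N <= `|m - 0|)%N then tau `|m - 0|%N else 0).
  by apply: eq_big_seq => m /NJ Nm; rewrite subr0 Nm.
by rewrite (le_lt_trans HK)// mulrC -ltr_pdivlMr.
Qed.

(** Telescoping, since [1 / (1 + k^2) <= 2 / k - 2 / (k + 1)]. The [maxn] in the strengthened claim
    accounts for the empty sum when [K <= N]. *)
Lemma sum_inv_sqr_tail (N K : nat) : (0 < N)%N ->
  \sum_(k < K) (if (N <= k)%N then (1 + k%:R ^+ 2)^-1 else 0) <= 2 / N%:R :> R.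
Proof.
move=> N0; have N0' : 0 < N%:R :> R by rewrite ltr0n.
suff H : \sum_(k < K) (if (N <= k)%N then (1 + k%:R ^+ 2)^-1 else 0)
    <= 2 / N%:R - 2 / (maxn N K)%:R :> R.
  by rewrite (le_trans H)// gerBl divr_ge0.
elim: K => [|K IH]; first by rewrite big_ord0 maxn0 subrr.
rewrite big_ord_recr/=; case: ifP => NK; last first.
  have -> : maxn N K.+1 = maxn N K by rewrite (maxn_idPl _) ?(maxn_idPl _)//; lia.
  by rewrite addr0.
have K0 : 0 < K%:R :> R by rewrite ltr0n; lia.
rewrite (maxn_idPr NK) in IH; rewrite (maxn_idPr (leqW NK)).
rewrite (le_trans (lerD IH (lexx _)))// -[K.+1%:R]natr1 -addrA lerD2l.
rewrite addrC lerBlDr -subr_ge0.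
have -> : - (2 / (K%:R + 1)) + 2 / K%:R - (1 + K%:R ^+ 2)^-1 =
   (K%:R ^+ 2 - K%:R + 2) / (K%:R * (K%:R + 1) * (1 + K%:R ^+ 2)) :> R.
  have ? : 1 + K%:R ^+ 2 != 0 :> R by rewrite gt_eqF// ltr_wpDr// sqr_ge0.
  by field; rewrite ?andbT gt_eqF//=; nra.
by apply: divr_ge0; nra.
Qed.

Lemma sum_inv_sqr_le (N : nat) : \sum_(k < N) (1 + k%:R ^+ 2)^-1 <= 3 :> R.
Proof.
case: N => [|N]; first by rewrite big_ord0.
rewrite big_ord_recl/= expr0n addr0 invr1.
have := @sum_inv_sqr_tail 1 N.+1 isT.
rewrite big_ord_recl/= add0r divr1 => H.
by apply: (le_trans (lerD (lexx 1) H)); lra.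
Qed.

(** Each new term [1 / (n + 2)] is at most [ln (n + 2) - ln (n + 1)], by [ln (1 + a) <= a] at
    [a = - 1 / (n + 2)]. *)
Lemma sum_inv_le_ln (n : nat) : (0 < n)%N ->
  \sum_(k < n) (1 + k%:R)^-1 <= 1 + ln n%:R :> R.
Proof.
case: n => // n _; elim: n => [|n IH].
  by rewrite big_ord1 addr0 invr1 ln1 addr0.
rewrite big_ord_recr/= (le_trans (lerD IH (lexx _)))// -addrA lerD2l -lerBrDl.
have n0 : 0 < n.+1%:R :> R by [].
have n20 : 0 < n.+2%:R :> R by [].
rewrite -lerN2 opprB -ln_div ?posrE// nat1r.
have -> : n.+1%:R / n.+2%:R = 1 + - n.+2%:R^-1 :> R.
  rewrite -[n.+2%:R]natr1; have : n.+1%:R + 1 != 0 :> R by rewrite natr1.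
  by move=> h; field.
by rewrite le_ln1Dx// ltrN2 invf_lt1// ltr1n.
Qed.

End unconditional_sums.

Section real_and_complex.
Context {R : realType}.
Implicit Types (a b : R) (z : R[i]).

Lemma normc_real a : `|a%:C : R[i]| = `|a|%:C.
Proof. by rewrite normc_def/= expr0n addr0 sqrtr_sqr. Qed.

Lemma normc_le_sum a b : `|a +i* b| <= (`|a| + `|b|)%:C.
Proof.
rewrite normc_def/= lecR -[leRHS]ger0_norm ?addr_ge0// -sqrtr_sqr ler_sqrt ?sqr_ge0//.
rewrite -(real_normK (num_real a)) -(real_normK (num_real b)).
have := normr_ge0 a; have := normr_ge0 b; nra.
Qed.

Lemma normc_expi a : `|expi a| = 1.
Proof. by rewrite /expi normc_def/= cos2Dsin2 sqrtr1. Qed.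

Lemma gt0_complex_real (e : R[i]) : 0 < e -> exists2 a : R, 0 < a & e = a%:C.
Proof. by case: e => a b; rewrite ltcE/= => /andP[/eqP -> a0]; exists a. Qed.

Lemma cvg_complex_real (u : nat -> R) (H : R) : u @ \oo --> H ->
  (fun M => (u M)%:C : R[i]^o) @ \oo --> (H%:C : R[i]^o).
Proof.
move=> /cvgrPdist_lt uH; apply/cvgrPdist_lt => e /gt0_complex_real[a a0 ->].
near=> M; rewrite -rmorphB/= normc_real ltcR; near: M; exact: uH.
Unshelve. all: by end_near. Qed.

End real_and_complex.

(** * Unconditional convergence of the lattice and Fourier series *)

Section summation_of_terms.
Context {R : realType}.
Notation mu := (@lebesgue_measure R).
Variables (p : R -> R) (K0 : R).
Hypothesis p0 : forall x, 0 <= p x.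
Hypothesis p_cont : continuous p.
Hypothesis ip : mu.-integrable setT (EFin \o p).
Hypothesis decay : forall x, p x <= K0 / (1 + x ^+ 2).
Variable y : R.

Let K00 : 0 <= K0. Proof. exact: decay_ge0 p0 decay. Qed.

Lemma lattice_summable (L : R) : (fun M => lattice_partial p y M 0) @ \oo --> L ->
  summability.partial_sum (fun m : int => p (2 * m%:~R + y)) @ summability.totally --> L.
Proof.
move=> cL; apply: partial_sum_cvg; last first.
  rewrite [X in X @ _](_ : _ = (fun M => lattice_partial p y M 0))//.
  apply/funext => M; rewrite /lattice_partial addr0 mulr0 add0r; congr (_ + _).
  apply: eq_bigr => k _; rewrite !addr0 addrC [y - _]addrC mulrNz mulrN.
  by rewrite addrC [y + _]addrC.
move=> e e0.
have [|N|N HN] := @fset_tail_lt R (fun k => K0 * (1 + k%:R ^+ 2)^-1) (K0 * 3) e _ _ e0.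
- by move=> k; rewrite mulr_ge0// invr_ge0 addr_ge0// sqr_ge0.
- by rewrite -mulr_sumr ler_wpM2l// sum_inv_sqr_le.
(* Once [|m| >= |y|], one has [|2 m + y| >= |m|], because [(2 m + y)^2 - m^2 = (3 m + y) (m + y)] is
   then nonnegative. The tail is compared with that of [K0 / (1 + m^2)]. *)
exists (maxn N (Num.bound `|y|)) => J NJ; rewrite ger0_norm ?sumr_ge0//.
have {}HN := HN J; apply: le_lt_trans (HN _); last first.
  by move=> m /NJ; rewrite geq_max => /andP[].
rewrite big_seq [leRHS]big_seq; apply: ler_sum => m /NJ; rewrite geq_max => /andP[_ ym].
rewrite (le_trans (decay _))// ler_wpM2l// lef_pV2 ?posrE ?ltr_wpDr ?sqr_ge0//.
rewrite lerD2l.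
have : `|y| <= `|m|%:R.
  by rewrite (le_trans (ltW (archi_boundP (normr_ge0 _))))// ler_nat.
rewrite natr_absz intr_norm real_normK ?num_real//; move: (m%:~R : R) => a ya.
rewrite -subr_ge0 (_ : _ - _ = (3 * a + y) * (a + y)); last by ring.
have [a0|a0] := lerP 0 a.
  by move: ya; rewrite (ger0_norm a0) => /ler_normlP[? ?]; apply: mulr_ge0; lra.
by move: ya; rewrite (ltr0_norm a0) => /ler_normlP[? ?]; apply: mulr_le0; lra.
Qed.

Let cosTN t : cosT p (- t) = cosT p t.
Proof. by apply: eq_Rintegral => x _; rewrite mulNr cosN. Qed.

Let sinTN t : sinT p (- t) = - sinT p t.
Proof.
rewrite /sinT -[RHS]mulN1r -RintegralZl//; last exact: integrable_sinT.
by apply: eq_Rintegral => x _; rewrite mulNr sinN; ring.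
Qed.

(** The exponential factors have modulus 1, so the tails are dominated by the samples [S] bounds; in
    the symmetric partial sums conjugate terms pair up and leave the real numbers [cos_partial]. *)
Lemma fourier_summable (S H : R) :
  (forall N, \sum_(k < N) (`|cosT p (pi * k%:R)| + `|sinT p (pi * k%:R)|) <= S) ->
  cos_partial p y @ \oo --> H ->
  summability.partial_sum (fun k : int => expi (- (pi * k%:~R * y)) *
     (cosT p (pi * k%:~R) +i* sinT p (pi * k%:~R)) : R[i]^o) @ summability.totally
  --> (H%:C : R[i]^o).
Proof.
move=> Sb cH; apply: partial_sum_cvg; last first.
  rewrite [X in X @ _](_ : _ = (fun M => (cos_partial p y M)%:C)); first exact: cvg_complex_real.
  apply/funext => M; rewrite /cos_partial rmorphD/= mulr_sumr rmorph_sum/=; congr (_ + _).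
    rewrite /expi /cos_term !mulr0 !mul0r oppr0 sin0 cos0 !mul0r addr0 mul1r.
    have -> : sinT p 0 = 0 by have := sinTN 0; rewrite oppr0; lra.
    by rewrite -[1 +i* 0]/(1%:C) mul1r.
  apply: eq_bigr => k _; rewrite /expi /cos_term mulrNz !mulrN !mulNr opprK.
  rewrite cosN sinN cosTN sinTN; apply/eqP; rewrite eq_complex/=.
  by apply/andP; split; apply/eqP; ring.
move=> e /gt0_complex_real[a a0 ->].
have [|N HN] := @fset_tail_lt R (fun k => `|cosT p (pi * k%:R)| + `|sinT p (pi * k%:R)|) S a _ Sb a0.
  by move=> k; rewrite addr_ge0.
exists N => J /HN {}HN; rewrite (le_lt_trans (ler_norm_sum _ _ _))//.
apply: (@le_lt_trans _ _ (\sum_(m <- J) (`|cosT p (pi * `|m|%:R)| + `|sinT p (pi * `|m|%:R)|))%:C).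
  rewrite rmorph_sum/=; apply: ler_sum => m _.
  rewrite normrM normc_expi mul1r.
  rewrite (le_trans (normc_le_sum _ _))// lecR.
  have [m0|m0] := lerP 0 m.
    by rewrite natr_absz (ger0_norm m0).
  have -> : m%:~R = - `|m|%:R :> R by rewrite natr_absz (ltr0_norm m0) mulrNz opprK.
  by rewrite mulrN cosTN sinTN normrN.
by rewrite ltcR.
Qed.

Lemma cos_partial_cvg (S : R) :
  (forall N, \sum_(k < N) (`|cosT p (pi * k%:R)| + `|sinT p (pi * k%:R)|) <= S) ->
  cvg (cos_partial p y @ \oo).
Proof.
move=> Sb; apply: is_cvgD; first exact: is_cvg_cst.
apply: is_cvgMr.
rewrite [X in X @ _](_ : _ = series (fun k => cos_term p y k.+1)); last first.
  by apply/funext => M; rewrite /series/= big_mkord.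
apply: normed_cvg; apply: nondecreasing_is_cvgn.
  by apply: (@nondecreasing_series R (fun k => `|cos_term p y k.+1|) xpredT 0) => k _ _.
exists S => _ [M _ <-]; apply: le_trans (Sb M.+1).
rewrite (_ : _ M = \sum_(k < M) `|cos_term p y k.+1|); last first.
  by rewrite -(big_mkord xpredT (fun k => `|cos_term p y k.+1|)).
rewrite big_ord_recl/= -[leLHS]add0r lerD ?addr_ge0//.
apply: ler_sum => k _; rewrite /cos_term (le_trans (ler_normD _ _))// !normrM.
by apply: lerD; rewrite ler_piMl// ?cos_norm_le1 ?sin_norm_le1.
Qed.

Lemma poisson_unconditional (S : R) :
  (forall N, \sum_(k < N) (`|cosT p (pi * k%:R)| + `|sinT p (pi * k%:R)|) <= S) ->
  exists2 L : R,
    summability.partial_sum (fun m : int => p (2 * m%:~R + y)) @ summability.totally --> L &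
    summability.partial_sum (fun k : int => expi (- (pi * k%:~R * y)) *
       (cosT p (pi * k%:~R) +i* sinT p (pi * k%:~R)) : R[i]^o) @ summability.totally
    --> ((2 * L)%:C : R[i]^o).
Proof.
move=> Sb; have /cvg_ex[/= H cH] := cos_partial_cvg Sb.
have c2 := poisson_summation p0 p_cont ip decay cH; exists (2^-1 * H).
  apply: lattice_summable.
  rewrite (_ : (fun M => _) = (fun M => 2^-1 * (2 * lattice_partial p y M 0))).
    exact: cvgMl_tmp.
  by apply/funext => M; rewrite mulKf.
by rewrite mulVKf//; exact: fourier_summable cH.
Qed.

End summation_of_terms.

(** * Comparison of the two lattice sums *)

Section gaussian_weights.
Context {R : realType}.
Notation phi := (normal_pdf (0 : R) 1).

(** Mean value theorem for [expR (- (x ^+ 2 / 2))]: its derivative at [c] is at most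
    [|c| / (1 + c^2 / 2) <= 1] in absolute value, and [2 * normal_peak 1 <= 1]. *)
Lemma normal_pdf01_lipschitz (a b : R) : 2 * `|phi a - phi b| <= `|a - b|.
Proof.
wlog ab : a b / a <= b.
  move=> H; case: (leP a b) => [/H//|/ltW /H].
  by rewrite distrC [X in _ <= X -> _]distrC.
pose g x : R := expR (- (x ^+ 2 / 2)).
have dg (x : R) : is_derive x 1 g (- (x * g x)).
  by rewrite /g; apply: is_derive_eq; rewrite /GRing.scale/=; field.
have [|c _ gab] := @MVT_segment R g (fun x => - (x * g x)) a b ab (fun x _ => dg x).
  apply: derivable_within_continuous => x _; by case: (dg x).
rewrite !normal_pdf01E -mulrBr normrM (ger0_norm (normal_peak_ge0 _)) mulrA.
rewrite -[leRHS]mul1r ler_pM// ?mulr_ge0 ?normal_peak_ge0// ?normal_peak1_le//.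
rewrite distrC -/(g a) -/(g b) gab normrM normrN normrM.
rewrite (distrC b a) ler_piMl// (ger0_norm (expR_ge0 _)).
rewrite (le_trans (ler_wpM2l _ (expRN_le_inv _)))// ?divr_ge0 ?sqr_ge0//.
rewrite ler_pdivrMr ?ltr_wpDr ?divr_ge0 ?sqr_ge0// mul1r -(real_normK (num_real c)).
have := normr_ge0 c; nra.
Qed.

Lemma normal_pdf01_le x : 0 <= 2 * phi x <= expR (- (x ^+ 2 / 2)).
Proof.
rewrite normal_pdf01E mulrA mulr_ge0 ?mulr_ge0 ?normal_peak_ge0 ?expR_ge0//=.
by rewrite ler_piMl ?expR_ge0// normal_peak1_le.
Qed.

(* The coefficient of [p (2 m + x sqrt n + n)] in the density of the normalized
   sum at [x]: the summation index [k] of [sum_density] is [m + n]. *)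
Definition lattice_weight (n : nat) (m : int) : R :=
  if - n%:Z <= m <= 0 then Num.sqrt n%:R * bin_half n `|m + n%:Z| else 0.

Lemma lattice_weight_ge0 n m : 0 <= lattice_weight n m.
Proof.
by rewrite /lattice_weight; case: ifP => // _; rewrite mulr_ge0 ?divr_ge0 ?exprn_ge0.
Qed.

Lemma sqrt_natr_ge1 n : (0 < n)%N -> 1 <= Num.sqrt n%:R :> R.
Proof. by move=> n0; rewrite -[leLHS]sqrtr1 ler_wsqrtr// ler1n. Qed.

(** Extends the local limit theorem to all integers [m]. Outside the support the weight is zero, but
    the Gaussian is evaluated at some [z] with [z ^+ 2 >= n] and is itself within the error. *)
Lemma lattice_weight_clt n m : (0 < n)%N ->
  `|lattice_weight n m - 2 * phi ((- (2 * m%:~R) - n%:R) / Num.sqrt n%:R)| <= 34 / Num.sqrt n%:R.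
Proof.
move=> n0; have rt1 := sqrt_natr_ge1 n0; rewrite /lattice_weight; case: ifPn => [/andP[mn m0]|mn].
  have kn : (absz (m + n%:Z)%R <= n)%N by lia.
  have := @local_clt R n _ n0 kn.
  suff -> : n%:R - 2 * `|m + n|%:R = - (2 * m%:~R) - n%:R :> R by [].
  by rewrite natr_absz ger0_norm; [rewrite intrD; ring|lia].
set z := (- _ - _) / _; have [phi0 phi1] := andP (normal_pdf01_le z).
rewrite sub0r normrN ger0_norm// (le_trans phi1)//.
rewrite (le_trans (expRN_le_inv _)) ?divr_ge0 ?sqr_ge0//.
have z2 : n%:R <= z ^+ 2.
  rewrite /z expr_div_n sqr_sqrtr// ler_pdivlMr ?ltr0n// -expr2.
  have -> : - (2 * m%:~R) - n%:R = (- (2 * m) - n%:Z)%:~R :> R.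
    by rewrite intrD !rmorphN/= rmorphM.
  have -> : n%:R = (n%:Z)%:~R :> R by [].
  rewrite -!rmorphXn/= ler_int; move: mn; rewrite negb_and -!ltNge => mn.
  have [H|H] : (n%:Z <= - (2 * m) - n%:Z \/ n%:Z <= 2 * m + n%:Z)%R by lia.
    by nia.
  by nia.
have z21 : 0 < 1 + z ^+ 2 / 2 by rewrite ltr_wpDr// divr_ge0 ?sqr_ge0.
rewrite ler_pdivlMr; last by lra.
rewrite -[leLHS]mulrC ler_pdivrMr//.
have : Num.sqrt n%:R <= n%:R :> R by rewrite -[leRHS]sqr_sqrtr// expr2 ler_peMl//; lra.
lra.
Qed.

Lemma lattice_weight_le n m : (0 < n)%N -> lattice_weight n m <= 35.
Proof.
move=> n0; have rt1 := sqrt_natr_ge1 n0; have := lattice_weight_clt m n0.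
set z := (- _ - _) / _; have [phi0 phi1] := andP (normal_pdf01_le z).
have e1 : expR (- (z ^+ 2 / 2)) <= 1 by rewrite -expR0 ler_expR oppr_le0 divr_ge0 ?sqr_ge0.
have h : 34 / Num.sqrt n%:R <= 34 :> R by rewrite ler_pdivrMr; lra.
by move=> /ler_normlP[_]; lra.
Qed.

(** The weight is close to the Gaussian at its own lattice point [z], and [z - x] is, up to sign,
    the argument of [p] divided by [sqrt n]. The error is thus small precisely where [p] is not. *)
Lemma lattice_weight_near n m x : (0 < n)%N -> `|lattice_weight n m - 2 * phi x| <=
  34 * (1 + `|2 * m%:~R + (x * Num.sqrt n%:R + n%:R)|) / Num.sqrt n%:R.
Proof.
move=> n0; have rt1 := sqrt_natr_ge1 n0; have := lattice_weight_clt m n0.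
have rt0 : 0 < Num.sqrt n%:R :> R by lra.
set z := (- _ - _) / _ => H; have L := normal_pdf01_lipschitz z x.
have zx : `|z - x| = `|2 * m%:~R + (x * Num.sqrt n%:R + n%:R)| / Num.sqrt n%:R.
  rewrite -[X in _ / X]gtr0_norm// -normf_div -normrN; congr `| _ |.
  by rewrite /z; field; rewrite gt_eqF.
have -> : lattice_weight n m - 2 * phi x =
    (lattice_weight n m - 2 * phi z) + 2 * (phi z - phi x) by ring.
rewrite (le_trans (ler_normD _ _))// normrM (ger0_norm (ler0n _ 2)).
apply: (le_trans (lerD H L)); rewrite zx -mulrDl ler_wpM2r ?invr_ge0 ?(ltW rt0)//.
by have := normr_ge0 (2 * m%:~R + (x * Num.sqrt n%:R + n%:R)); lra.
Qed.

Lemma lattice_weight_dist n m x : (0 < n)%N -> `|lattice_weight n m - 2 * phi x| <= 35.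
Proof.
move=> n0; have := lattice_weight_le m n0; have := lattice_weight_ge0 n m.
have [phi0 phi1] := andP (normal_pdf01_le x).
have e1 : expR (- (x ^+ 2 / 2)) <= 1 by rewrite -expR0 ler_expR oppr_le0 divr_ge0 ?sqr_ge0.
by move=> ? ?; apply/ler_normlP; split; lra.
Qed.

(* Bounds a term of the lattice sums by its distance to a centre, uniformly in [y]. *)
Lemma lattice_center (y : R) :
  exists m0 : int, forall m : int, `|m - m0|%:R <= `|2 * m%:~R + y|.
Proof.
(* [- f] is an integer nearest to [- y / 2], so [2 m + y] differs by at most 1 from twice the
   distance [l], taken with sign, and [2 |l| - 1 >= |l|] unless [l = 0]. *)
pose f := Num.floor ((y + 1) / 2); exists (- f) => m.
have [f1 f2] := andP (floor_itv ((y + 1) / 2)); rewrite -/f in f1 f2.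
rewrite natr_absz; set l := m - - f.
have -> : 2 * m%:~R + y = 2 * l%:~R + (y - 2 * f%:~R).
  by rewrite /l opprK intrD; ring.
have yf : `|y - 2 * f%:~R| <= 1.
  by rewrite intrD in f2; apply/ler_normlP; split; lra.
have [->|l0] := eqVneq l 0; first by rewrite normr0.
have l1 : 1 <= `|l%:~R| :> R by rewrite -intr_norm ler1z; lia.
have := lerB_normD (2 * l%:~R) (y - 2 * f%:~R).
rewrite normrM (ger0_norm (ler0n _ 2)) intr_norm; lra.
Qed.

(** * Weighted lattice sums, uniformly in the point *)

Section weighted_sums.
Variables (p : R -> R) (K0 : R).
Hypothesis p0 : forall x, 0 <= p x.
Hypothesis decay : forall x, p x <= K0 / (1 + x ^+ 2).
Variables (n : nat) (x : R).
Hypothesis n0 : (0 < n)%N.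
Notation y := (x * Num.sqrt n%:R + n%:R).
Notation rt := (Num.sqrt n%:R).

Let K00 : 0 <= K0. Proof. exact: decay_ge0 p0 decay. Qed.
Let rt1 : 1 <= rt :> R. Proof. exact: sqrt_natr_ge1. Qed.

Let decay_far (a : R) (l : nat) : l%:R <= `|a| -> p a <= K0 / (1 + l%:R ^+ 2).
Proof.
move=> la; rewrite (le_trans (decay a))// ler_wpM2l// lef_pV2 ?posrE ?ltr_wpDr ?sqr_ge0//.
by rewrite lerD2l -(real_normK (num_real a)) lerXn2r ?nnegrE.
Qed.

(** The constant is [2 * 35 * 3]: two lattice points at each distance from the centre, the bound on
    the weights, and the sum of [1 / (1 + k^2)]. *)
Lemma weighted_sum_bounded (w : int -> R) (J : {fset int}) :
  (forall m, `|w m| <= 35) -> \sum_(m <- J) `|w m| * p (2 * m%:~R + y) <= 210 * K0.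
Proof.
move=> w35; have [m0 Hm0] := lattice_center y.
have [|K HK] := @sum_fset_int_le R (fun k => 35 * K0 * (1 + k%:R ^+ 2)^-1) J m0.
  by move=> k; rewrite mulr_ge0 ?mulr_ge0// invr_ge0 addr_ge0// sqr_ge0.
rewrite (le_trans _ (le_trans HK _))//.
  apply: ler_sum => m _; rewrite -mulrA ler_pM//.
  exact: decay_far.
rewrite -mulr_sumr; have := ler_wpM2l K00 (sum_inv_sqr_le (R := R) K).
by move: (\sum_(k < K) _) => s; lra.
Qed.

(** At distances [l < n] from the centre the second bound on [w] is used, and
    [(1 + b) (1 + l) <= 2 (1 + b^2)] for [b >= l] turns the term into [68 * K0 / (rt * (1 + l))];
    these sum to a logarithm. Farther out the bound 35 leaves a tail of order [1 / n]. The constant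
    is [2 * (68 * 2 + 35 * 2)], where [1 + ln n <= 2 * ln n]. *)
Lemma weighted_sum_small (w : int -> R) (J : {fset int}) :
  (forall m, `|w m| <= 35) -> (forall m, `|w m| <= 34 * (1 + `|2 * m%:~R + y|) / rt) ->
  1 <= ln n%:R :> R ->
  \sum_(m <- J) `|w m| * p (2 * m%:~R + y) <= 412 * K0 * (ln n%:R / rt).
Proof.
move=> w35 wrt ln1; have [m0 Hm0] := lattice_center y.
pose t1 k : R := if (n <= k)%N then 0 else (1 + k%:R)^-1.
pose t2 k : R := if (n <= k)%N then (1 + k%:R ^+ 2)^-1 else 0.
have t10 k : 0 <= t1 k by rewrite /t1; case: ifP => // _; rewrite invr_ge0 addr_ge0.
have t20 k : 0 <= t2 k by rewrite /t2; case: ifP => // _; rewrite invr_ge0 addr_ge0// sqr_ge0.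
have rt0 : 0 < rt :> R by apply: lt_le_trans rt1.
have [|K HK] := @sum_fset_int_le R (fun k => 68 * K0 / rt * t1 k + 35 * K0 * t2 k) J m0.
  by move=> k; rewrite addr_ge0 ?mulr_ge0 ?invr_ge0 ?(ltW rt0).
rewrite (le_trans _ (le_trans HK _))//.
  apply: ler_sum => m _; set l := absz (m - m0).
  rewrite /t1 /t2; case: ifPn => nl.
    rewrite mulr0 add0r -mulrA ler_pM//.
    by apply: decay_far; exact: Hm0.
  rewrite mulr0 addr0; set a := 2 * m%:~R + y.
  have al : l%:R <= `|a| by exact: Hm0.
  apply: (le_trans (ler_pM (normr_ge0 _) (p0 a) (wrt m) (decay a))); rewrite -/a.
  rewrite -(real_normK (num_real a)).
  have : 0 <= `|a| by [].
  move: al; move: (`|a| : R) => b lb b0.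
  have -> : 34 * (1 + b) / rt * (K0 / (1 + b ^+ 2)) =
     K0 / rt * (34 * (1 + b) / (1 + b ^+ 2)).
    by field; rewrite !gt_eqF// ltr_wpDr ?sqr_ge0.
  have -> : 68 * K0 / rt * (1 + l%:R)^-1 = K0 / rt * (68 / (1 + l%:R)) :> R.
    by field; rewrite !gt_eqF// ltr_wpDr.
  apply: ler_wpM2l; first by rewrite divr_ge0 ?(ltW rt0).
  have l0 : 0 <= l%:R :> R by [].
  rewrite ler_pdivlMr ?ltr_wpDr// mulrAC ler_pdivrMr ?ltr_wpDr ?sqr_ge0//.
  have := ler_wpM2l (addr_ge0 ler01 b0) lb; have := sqr_ge0 (b - 1).
  by rewrite sqrrB expr1n expr2; nra.
have S1 : \sum_(k < K) t1 k <= 2 * ln n%:R.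
  apply: (@le_trans _ _ (\sum_(k < n) (1 + k%:R)^-1)).
    rewrite (big_ord_widen (maxn K n) t1) ?leq_maxl//.
    rewrite (big_ord_widen (maxn K n) (fun k => (1 + k%:R)^-1 : R)) ?leq_maxr//.
    rewrite [leLHS]big_mkcond [leRHS]big_mkcond/=; apply: ler_sum => k _.
    by rewrite /t1 ltnNge [(k < n)%N]ltnNge; do 2 case: ifP => //= _; rewrite invr_ge0 addr_ge0.
  by rewrite (le_trans (sum_inv_le_ln n0))//; lra.
have S2 : \sum_(k < K) t2 k <= 2 / n%:R by exact: sum_inv_sqr_tail.
have S3 : 2 / n%:R <= 2 * (ln n%:R / rt) :> R.
  rewrite ler_pM2l// (@le_trans _ _ rt^-1)//.
    rewrite lef_pV2 ?posrE ?ltr0n//.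
    by rewrite -[leRHS]sqr_sqrtr// expr2 ler_peMl// ltW.
  by rewrite -[leLHS]mul1r ler_wpM2r// invr_ge0 ltW.
rewrite big_split/= -!mulr_sumr.
have A1 : 68 * K0 / rt * \sum_(k < K) t1 k <= K0 * (136 * (ln n%:R / rt)).
  rewrite (le_trans (ler_wpM2l _ S1)) ?divr_ge0 ?mulr_ge0 ?(ltW rt0)//.
  by rewrite le_eqVlt; apply/orP; left; apply/eqP; field; rewrite gt_eqF.
have A2 : 35 * K0 * \sum_(k < K) t2 k <= K0 * (70 * (ln n%:R / rt)).
  rewrite (le_trans (ler_wpM2l _ (le_trans S2 S3))) ?mulr_ge0//.
  by rewrite le_eqVlt; apply/orP; left; apply/eqP; ring.
by move: A1 A2; move: (ln n%:R / rt) => q; lra.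
Qed.

(** The weights vanish off the support, so [J] may be any larger finite set; this freedom lets the
    density be compared term by term with a partial sum of the lattice series. *)
Lemma sum_density_lattice (J : {fset int}) :
  ([fset (k%:Z - n%:Z)%R | k : nat in iota 0 n.+1] `<=` J)%fset ->
  rt * sum_density p n (rt * x) = \sum_(m <- J) lattice_weight n m * p (2 * m%:~R + y).
Proof.
move=> J0J; rewrite -(big_fset_incl _ J0J); last first.
  move=> m _ mJ0; rewrite /lattice_weight; case: ifP; rewrite ?mul0r// => /andP[mn m0'].
  exfalso; move/negP: mJ0; apply; apply/imfsetP; exists (absz (m + n%:Z)%R); last by lia.
  by rewrite inE mem_iota; lia.
rewrite big_imfset; last by move=> a b _ _; lia.
rewrite (perm_big (iota 0 n.+1)); last first.
  apply: uniq_perm; rewrite ?enum_finmem_uniq ?iota_uniq// => k.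
  by rewrite enum_finmemE.
rewrite /sum_density mulr_sumr -(big_mkord xpredT
  (fun k => rt * (bin_half n k * p (rt * x - n%:R + 2 * k%:R)))) /index_iota subn0.
apply: eq_big_seq => k; rewrite mem_iota add0n /= => kn.
rewrite /lattice_weight ifT; last by lia.
rewrite subrK mulrA absz_nat; congr (_ * p _).
by rewrite intrD mulrNz; ring.
Qed.

Lemma sum_density_bounded : rt * sum_density p n (rt * x) <= 210 * K0.
Proof.
rewrite (sum_density_lattice (fsubset_refl _)).
apply: le_trans (weighted_sum_bounded (w := lattice_weight n) _ _).
  by apply: ler_sum => m _; rewrite ler_wpM2r// ler_norm.
by move=> m; rewrite ger0_norm ?lattice_weight_ge0// lattice_weight_le.
Qed.

Lemma sum_density_near (L : R) : 1 <= ln n%:R :> R ->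
  summability.partial_sum (fun m : int => p (2 * m%:~R + y)) @ summability.totally --> L ->
  `|rt * sum_density p n (rt * x) - 2 * phi x * L| <= 412 * K0 * (ln n%:R / rt).
Proof.
move=> ln1 /cvgrPdist_lt cL; apply/ler_addgt0Pr => e e0.
have [A _ HA] := cL _ e0.
set J0 := [fset (k%:Z - n%:Z)%R | k : nat in iota 0 n.+1]%fset.
(* The union makes the partial sum of the lattice series [e]-close to [L] and at the same time
   contains every index that contributes to the density. *)
have := HA (A `|` J0)%fset (fsubsetUl _ _).
rewrite /= /summability.partial_sum -(big_seq_fsetE _ _ xpredT (fun m : int => p (2 * m%:~R + y)))/=.
rewrite (sum_density_lattice (fsubsetUr A J0)); set S := \sum_(_ <- _) p _ => LS.
have [phi0 phi1] := andP (normal_pdf01_le x).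
have phi2 : 2 * phi x <= 1.
  by rewrite (le_trans phi1)// -expR0 ler_expR oppr_le0 divr_ge0 ?sqr_ge0.
set W := \sum_(_ <- _) (_ * _).
have -> : W - 2 * phi x * L = (W - 2 * phi x * S) - 2 * phi x * (L - S) by ring.
rewrite (le_trans (ler_normB _ _))// lerD//; last first.
  by rewrite normrM (ger0_norm phi0) (le_trans _ (ltW LS))// ler_piMl.
rewrite (le_trans _ (@weighted_sum_small (fun m => lattice_weight n m - 2 * phi x)
  (A `|` J0)%fset _ _ ln1))//.
- rewrite /W /S mulr_sumr -sumrB (le_trans (ler_norm_sum _ _ _))//.
  by apply: ler_sum => m _; rewrite -mulrBl normrM (ger0_norm (p0 _)).
- by move=> m; exact: lattice_weight_dist.
- by move=> m; exact: lattice_weight_near.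
Qed.

End weighted_sums.

End gaussian_weights.

Theorem theorem7p1 (R : realType) (p : R -> R)
    (p_cont : continuous p) (p_bv : bounded_total_variation p) :
  exists (C : R) (N : nat),
  forall (d : measure_display) (T : measurableType d) (P : probability T R)
    (X : {RV P >-> R}) (xi : nat -> {RV P >-> R}),
  ('E_P[fun w => (X w ^+ 2)%R] < +oo)%E ->
  is_density P X p ->
  cintegrable (charfun P X) ->
  cintegrable (cderive1 (charfun P X)) ->
  cintegrable (cderive1 (cderive1 (charfun P X))) ->
  (forall i, symmetric_bernoulli P (xi i)) ->
  mutually_independent P (cons_rv X xi) ->
  exists p_ : nat -> R -> R,
  [/\ forall n, (0 < n)%N -> is_density P (Zsum X xi n) (p_ n),
      exists M : R, forall n x, (0 < n)%N -> p_ n x <= M,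
      forall n x, (0 < n)%N ->
        [/\ summableZ (fourier_term (charfun P X) n x),
            summableZ (lattice_term p n x) &
            A_ (charfun P X) n x =
              (2 * summability.sum (lattice_term p n x))%:C] &
      forall n x, (N <= n)%N ->
        `| (p_ n x)%:C - A_ (charfun P X) n x * (normal_pdf 0 1 x)%:C |
          <= (C * (ln n%:R / Num.sqrt n%:R))%:C].
Proof.
(* The constants must be given before [X]. Decay is a property of [p] alone: if it fails,
   [density_decay] shows that no [X] satisfies the hypotheses, and any constants do. *)
have [[K0 decay]|noK0] := pselect (exists K0 : R, forall x, p x <= K0 / (1 + x ^+ 2)); last first.
  by exists 0, 0%N => d T P X xi X2 dX if0 if1 if2; case: noK0; exact: density_decay dX if0 if2.
(* The threshold ensures [n >= e], that is [1 <= ln n], as [sum_density_near] requires. *)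
exists (412 * K0), (Num.bound (expR 1 : R)) => d T P X xi X2 dX if0 if1 if2 xi_pm1 indep.
have p0 : forall x, 0 <= p x by case: dX.
have ip := density_integrable dX.
have [S Sb] := charfun_samples_bounded X2 dX if0 if1.
have sums n x : exists L : R,
    [/\ summability.partial_sum (lattice_term p n x) @ summability.totally --> L,
        summability.partial_sum (fourier_term (charfun P X) n x) @ summability.totally
          --> ((2 * L)%:C : R[i]^o) &
        A_ (charfun P X) n x = (2 * L)%:C].
  have [L cl cf] := poisson_unconditional p0 p_cont ip decay (x * Num.sqrt n%:R + n%:R) Sb.
  have ftE : fourier_term (charfun P X) n x = (fun k : int =>
      expi (- (pi * k%:~R * (x * Num.sqrt n%:R + n%:R))) *
      (cosT p (pi * k%:~R) +i* sinT p (pi * k%:~R)) : R[i]^o).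
    by apply/funext => k; rewrite /fourier_term (charfunE dX).
  exists L; split; last 2 first.
  - by rewrite ftE.
  - by rewrite /A_ ftE; apply: (cvg_lim _ cf); exact: norm_hausdorff.
  rewrite (_ : lattice_term p n x = (fun m : int => p (2 * m%:~R + (x * Num.sqrt n%:R + n%:R))))//.
  by apply/funext => m; rewrite /lattice_term addrA.
exists (fun n x => Num.sqrt n%:R * sum_density p n (Num.sqrt n%:R * x)); split.
- by move=> n n0; exact: (Zsum_density dX xi_pm1 indep).
- by exists (210 * K0) => n x n0; exact: sum_density_bounded.
- move=> n x n0; have [L [cl cf ->]] := sums n x; split.
  + by apply/cvg_ex; exists (2 * L)%:C.
  + by apply/cvg_ex; exists L.
  + by congr (2 * _)%:C; apply/esym/cvg_lim => //; exact: norm_hausdorff.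
- move=> n x Nn; have [L [cl _ ->]] := sums n x.
  have en : expR 1 <= n%:R :> R.
    by rewrite (le_trans (ltW (archi_boundP (expR_ge0 1))))// ler_nat.
  have n0 : (0 < n)%N by rewrite -(ltr0n R) (lt_le_trans _ en)// expR_gt0.
  have ln1 : 1 <= ln n%:R :> R by rewrite -ler_expR lnK// posrE ltr0n.
  rewrite -rmorphM -rmorphB/= normc_real lecR mulrAC.
  apply: sum_density_near => //.
  rewrite (_ : (fun m : int => _) = lattice_term p n x)//.
  by apply/funext => m; rewrite /lattice_term addrA.
Qed.
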